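(* Fix a positive integer $q$ and real numbers $\delta\in(0,\infty)$, $\beta\in(-\infty,1]$. Consider a sequence of multivariate allometric regression models as described in the context, along which $n$ and $p$ tend to $\infty$ in such a way that $n/p^{\delta}$ converges to a finite positive value, with $q$ held fixed, and such that (i) $\|\boldsymbol{X}\boldsymbol{\alpha}\|^2=\Theta(p^{\delta})$; (ii) $\mathrm{tr}(\boldsymbol{\Sigma})=\Theta(p)$ and $\lambda_1-\lambda_2=\Theta(p^{\beta})$. Let $w^*$ (varying along the sequence) be the weight defined in the context. If \[ \delta>\min\{2-2\beta,\,1\}, \] then \[ \min_{\theta\in\{-1,1\}} \| \theta\hat{\boldsymbol{\gamma}}_1(w^* )-\boldsymbol{\gamma}_1\| \to 0 \quad\text{in probability}. \]
   Context: Model (for each member of the sequence). Let $n,p,q$ be positive integers with $p\ge 2$ and $n>1+q$. Let $\boldsymbol{X}$ be a deterministic real $n\times q$ matrix with $\mathrm{rank}(\boldsymbol{X})=q$ and $\boldsymbol{X}'\boldsymbol{1}_n=\boldsymbol{0}_q$ (here $'$ is transpose and $\boldsymbol{1}_n$ is the all-ones vector), $\boldsymbol{\mu}\in\mathbb{R}^p$, $\boldsymbol{\alpha}\in\mathbb{R}^q$. Let $\boldsymbol{\Sigma}$ be a $p\times p$ positive-definite matrix with eigenvalues $\lambda_1>\lambda_2\ge\cdots\ge\lambda_p>0$, and let $\boldsymbol{\gamma}_1$ be a unit eigenvector of $\boldsymbol{\Sigma}$ for $\lambda_1$ (all of these except $q$ may vary along the sequence). The observed $n\times p$ matrix is \[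 \boldsymbol{Y} = \boldsymbol{1}_n\boldsymbol{\mu}' + \boldsymbol{X}\boldsymbol{\alpha}\boldsymbol{\gamma}_1' + \boldsymbol{E},\qquad \mathrm{vec}(\boldsymbol{E})\sim \mathcal{N}_{np}(\boldsymbol{0}_{np},\boldsymbol{\Sigma}\otimes \boldsymbol{I}_n), \] i.e. the rows of $\boldsymbol{E}$ are i.i.d. $\mathcal{N}_p(\boldsymbol{0}_p,\boldsymbol{\Sigma})$. Estimators. Let \[ \boldsymbol{S}_R = \boldsymbol{Y}'\boldsymbol{X}(\boldsymbol{X}'\boldsymbol{X})^{-1}\boldsymbol{X}'\boldsymbol{Y},\qquad \boldsymbol{S}_E = \boldsymbol{Y}'\Bigl\{ \boldsymbol{I}_n - \tfrac1n\boldsymbol{1}_n\boldsymbol{1}_n' - \boldsymbol{X}(\boldsymbol{X}'\boldsymbol{X})^{-1}\boldsymbol{X}' \Bigr\}\boldsymbol{Y}, \] and $\boldsymbol{S}(w) = (1-w)\boldsymbol{S}_R + w\boldsymbol{S}_E$ for $0\le w\le 1$. The estimator $\hat{\boldsymbol{\gamma}}_1(w)$ is the first principal eigenvector of $\boldsymbol{S}(w)$, i.e. a unit eigenvector of $\boldsymbol{S}(w)$ corresponding to its largest eigenvalue. $\|\cdot\|$ is the Euclidean norm. Weight. With $a = \mathrm{tr}(\boldsymbol{\Sigma}^2) + (\mathrm{tr}(\boldsymbol{\Sigma}))^2$, $b = \lambda_1 + \mathrm{tr}(\boldsymbol{\Sigma})$, $c = \| \boldsymbol{X}\boldsymbol{\alpha}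 \|^2$, $d = \lambda_1-\lambda_2$, \[ w^* = \frac{adq+2bcd}{2adq+2bcd+ac}\in[0,1]. \] Notation. A quantity $x$ varying along the sequence satisfies $x=\Theta(p^u)$ if $\liminf (x/p^u)>0$ and $\limsup (x/p^u)<\infty$ along the sequence. *)

(* Defs.v *)
From HB Require Import structures.
From mathcomp Require Import all_boot all_order all_algebra.
From mathcomp Require Import all_classical all_reals all_analysis.
From mathcomp Require Export mxtens.

Set Implicit Arguments.
Unset Strict Implicit.
Unset Printing Implicit Defensive.

Import Order.TTheory GRing.Theory Num.Theory.
Import numFieldNormedType.Exports.

Local Open Scope classical_set_scope.
Local Open Scope ring_scope.

(* Not the library norm [`|v|] on matrices, which is the sup norm. *)
Definition enorm (R : realType) (m : nat) (v : 'cV[R]_m) : R :=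
  Num.sqrt (\sum_(i < m) v i 0 ^+ 2).

Definition posdef (R : realType) (m : nat) (A : 'M[R]_m) : Prop :=
  A^T = A /\ forall v : 'cV[R]_m, v != 0 -> 0 < (v^T *m A *m v) 0 0.

(* The real numbers lam 0, ..., lam (m - 1) are the eigenvalues of A, repeated
   according to multiplicity; the values lam i for i >= m are irrelevant. *)
Definition eigenvalues_of (R : realType) (m : nat) (A : 'M[R]_m)
    (lam : nat -> R) : Prop :=
  char_poly A = \prod_(i < m) ('X - (lam i)%:P).

(* [eigenvalue] is defined with row vectors, but a square matrix and its
   transpose have the same eigenvalues. *)
Definition principal_eigenvector (R : realType) (m : nat) (A : 'M[R]_m)
    (v : 'cV[R]_m) : Prop :=
  enorm v = 1 /\
  exists l : R, A *m v = l *: v /\ forall l' : R, eigenvalue A l' -> l' <= l.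

(* Stacks the columns of A: the entry A i j has position j * n + i, which is
   [mxtens_index (j, i)], the indexing used by the Kronecker product [*t]. *)
Definition vec (R : realType) (n p : nat) (A : 'M[R]_(n, p)) : 'cV[R]_(p * n) :=
  \col_k A (mxtens_unindex k).2 (mxtens_unindex k).1.

(* N(m, s2), with variance s2 >= 0. The library's [normal_prob] takes the
   standard deviation, and for standard deviation 0 it is not a point mass. *)
Definition gaussian (R : realType) (m s2 : R) :
    set (measurableTypeR R) -> \bar R :=
  if s2 == 0 then dirac m else normal_prob m (Num.sqrt s2).

Definition has_law (R : realType) (d : measure_display) (T : measurableType d)
    (P : probability T R) (Z : T -> R)
    (mu : set (measurableTypeR R) -> \bar R) : Prop :=
  measurable_fun [set: T] Z /\
  forall B : set (measurableTypeR R), measurable B -> pushforward P Z B = mu B.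

(* Z ~ N_m(mu, V): every linear form t'Z has law N(t'mu, t'Vt). Taking for t the
   unit vectors, this includes the measurability of the entries of Z. *)
Definition mvnormal (R : realType) (d : measure_display) (T : measurableType d)
    (P : probability T R) (m : nat) (Z : T -> 'cV[R]_m)
    (mu : 'cV[R]_m) (V : 'M[R]_m) : Prop :=
  forall t : 'cV[R]_m,
    has_law P (fun w => (t^T *m Z w) 0 0)
      (gaussian ((t^T *m mu) 0 0) ((t^T *m V *m t) 0 0)).

Definition random_vector (R : realType) (d : measure_display)
    (T : measurableType d) (m : nat) (Z : T -> 'cV[R]_m) : Prop :=
  forall i : 'I_m, measurable_fun [set: T] (fun w => Z w i 0).

(* eigval i is the (i + 1)-st largest eigenvalue, for i < dimy. *)
Record allometric_model (R : realType) (q : nat) := AllometricModel {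
  nobs : nat;
  dimy : nat;
  design : 'M[R]_(nobs, q);
  mean : 'cV[R]_dimy;
  coeff : 'cV[R]_q;
  Sigma : 'M[R]_dimy;
  eigval : nat -> R;
  gamma1 : 'cV[R]_dimy;
  disp : measure_display;
  sample : measurableType disp;
  prob : probability sample R;
  noise : sample -> 'M[R]_(nobs, dimy);

  dimy_ge2 : (2 <= dimy)%N;
  nobs_gt : (1 + q < nobs)%N;
  rank_design : \rank design = q;
  design_centered : design^T *m (const_mx 1 : 'cV[R]_nobs) = 0;
  Sigma_posdef : posdef Sigma;
  Sigma_eigval : eigenvalues_of Sigma eigval;
  eigval1_gt : eigval 1 < eigval 0;
  eigval_noninc : forall i j : nat,
    (1 <= i)%N -> (i <= j)%N -> (j < dimy)%N -> eigval j <= eigval i;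
  eigval_gt0 : forall i : nat, (i < dimy)%N -> 0 < eigval i;
  gamma1_unit : enorm gamma1 = 1;
  gamma1_eigen : Sigma *m gamma1 = eigval 0 *: gamma1;
  noise_normal :
    mvnormal prob (fun w => vec (noise w)) 0 (Sigma *t (1%:M : 'M[R]_nobs))
}.

Section Estimators.
Context (R : realType) (q : nat) (M : allometric_model R q).

Let n := nobs M.
Let p := dimy M.
Let X : 'M[R]_(n, q) := design M.
Let ones : 'cV[R]_n := const_mx 1.

Definition obs (w : sample M) : 'M[R]_(n, p) :=
  ones *m (mean M)^T + X *m coeff M *m (gamma1 M)^T + noise w.

Definition proj_design : 'M[R]_n := X *m invmx (X^T *m X) *m X^T.

Definition S_R (w : sample M) : 'M[R]_p :=
  (obs w)^T *m proj_design *m obs w.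

Definition S_E (w : sample M) : 'M[R]_p :=
  (obs w)^T *m (1%:M - n%:R^-1 *: (ones *m ones^T) - proj_design) *m obs w.

Definition S_mix (wt : R) (w : sample M) : 'M[R]_p :=
  (1 - wt) *: S_R w + wt *: S_E w.

Definition signal : R := enorm (X *m coeff M) ^+ 2.

Definition eigengap : R := eigval M 0 - eigval M 1.

Definition optimal_weight : R :=
  let a := \tr (Sigma M *m Sigma M) + \tr (Sigma M) ^+ 2 in
  let b := eigval M 0 + \tr (Sigma M) in
  let c := signal in
  let d := eigengap in
  (a * d * q%:R + 2 * b * c * d) / (2 * a * d * q%:R + 2 * b * c * d + a * c).

Definition sign_dist (v : 'cV[R]_p) : R :=
  Num.min (enorm (1 *: v - gamma1 M)) (enorm (- 1 *: v - gamma1 M)).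

End Estimators.

(* x_k = Theta(p_k ^ u) as k tends to infinity *)
Definition Theta_pow (R : realType) (x : nat -> R) (p : nat -> nat) (u : R) :
    Prop :=
  (0 < limn_einf (fun k => (x k / (p k)%:R `^ u)%:E))%E /\
  (limn_esup (fun k => (x k / (p k)%:R `^ u)%:E) < +oo)%E.

(* The probability space may change with k. *)
Definition cvg_prob0 (R : realType) (d : nat -> measure_display)
    (T : forall k, measurableType (d k)) (P : forall k, probability (T k) R)
    (Z : forall k, T k -> R) : Prop :=
  forall eps : R, 0 < eps ->
    P k [set w | eps < `|Z k w|] @[k --> \oo] --> 0%E.

(* Main.v *)
(* The population version of S(w) has leading eigenvector gamma_1 with spectral gap
   G = (1 - w)(c + q d) + w m d, where m = n - 1 - q, and S(w) deviates from it by a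
   matrix whose expected squared Frobenius norm is at most a constant times
   V = (1 - w)^2 (q a + 2 b c) + w^2 m a (fourth moments of Gaussian forms). By the
   Davis-Kahan argument and Markov's inequality the error probability is at most a
   constant times V / G^2. The weight w* minimises this ratio, with
   G^2 / V = (c + q d)^2 / (q a + 2 b c) + m d^2 / a; the first term tends to
   infinity when delta > 1, and the second when delta > 2 - 2 beta. *)
Require Import Defs.
From mathcomp Require Import all_boot all_order all_algebra.
From mathcomp Require Import all_classical all_reals all_analysis.
From mathcomp Require Import measurable_realfun ring lra.

Set Implicit Arguments.
Unset Strict Implicit.
Unset Printing Implicit Defensive.

Import Order.TTheory GRing.Theory Num.Theory.
Import numFieldNormedType.Exports.

Local Open Scope classical_set_scope.
Local Open Scope ring_scope.

(** * Gaussian moments *)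

(** Normality is available only through the laws of linear forms, so every joint moment of the noise
    is recovered by polarisation from second and fourth moments of one-dimensional Gaussians. The
    eigenvalues are given as roots of the characteristic polynomial. The gap inequality for Sigma is
    therefore obtained by deflation: subtracting a multiple of gamma_1 gamma_1' moves a single root,
    after which the Rayleigh bound applies to the deflated matrix. The form of w* comes from
    Cauchy-Schwarz. G is linear in (1 - w, w), with coefficients c + q d and m d. V has no cross
    term, because the two projections that define S_R and S_E annihilate each other. Hence G^2 / V
    is largest when 1 - w and w are in the ratio of (c + q d) / (q a + 2 b c) to d / a, and the
    maximum is the sum of the two separate ratios. Finally lambda_1 <= tr Sigma and tr(Sigma^2) <=
    (tr Sigma)^2 bound a and b by the trace alone, whose order is known. *)

Lemma ge0_integral_normal_prob (R : realType) (m s : R)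
    (f : measurableTypeR R -> R) :
  (forall x, 0 <= f x) -> measurable_fun [set: measurableTypeR R] f ->
  (\int[normal_prob m s]_x (f x)%:E =
   \int[lebesgue_measure]_x (f x * normal_pdf m s x)%:E)%E.
Proof.
move=> f0 mf.
have dom := normal_prob_dominates m s.
rewrite -(Radon_Nikodym_SigmaFinite.change_of_variables dom)//; last first.
- exact/measurable_EFinP.
under [RHS]eq_integral do rewrite EFinM.
have iRN := Radon_Nikodym_SigmaFinite.f_integrable dom.
apply: ae_eq_integral => //.
- apply: emeasurable_funM; first exact/measurable_EFinP.
  exact: measurable_int iRN.
- apply: emeasurable_funM; first exact/measurable_EFinP.
  by apply/measurable_EFinP; exact: measurable_normal_pdf.
(* The Radon-Nikodym derivative and [normal_pdf] agree almost everywhere because they have the same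
   integral over every measurable set. *)
- apply: ae_eqe_mul2l; apply: integral_ae_eq => //.
  + by apply/measurable_EFinP; exact: measurable_normal_pdf.
  + by move=> A _ mA; rewrite -Radon_Nikodym_SigmaFinite.f_integral.
Qed.

Lemma harmonic_bound_cvg0 (R : realType) (u : nat -> R) (C : R) :
  (forall n, `|u n| <= C / n.+1%:R) -> u n @[n --> \oo] --> 0.
Proof.
move=> uC; apply: norm_cvg0.
apply: (@squeeze_cvgr _ _ _ _ (fun=> 0) (fun n => C * harmonic n)).
- by near=> n; rewrite normr_ge0/= uC.
- exact: cvg_cst.
- rewrite -[X in _ --> X](mulr0 C); apply: cvgMl_tmp; exact: cvg_harmonic.
Unshelve. all: by end_near. Qed.

Lemma bigcup_sym_itv (R : realType) :
  \bigcup_n `[- n.+1%:R, n.+1%:R]%classic = [set: R].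
Proof.
rewrite -subTset => x _.
exists (Num.truncn `|x|) => //=.
rewrite in_itv/= -ler_norml; exact/ltW/truncnS_gt.
Qed.

(* The fundamental theorem of calculus on [-n, n] makes the integrals of f and g
   differ by the boundary term G n - G (- n); monotone convergence then transfers
   the value of one improper integral to the other without any a priori
   integrability of f. *)
Lemma integral_eq_boundary0 (R : realType) (f g G : R -> R) (C I : R) :
  (forall x, 0 <= f x) -> (forall x, 0 <= g x) ->
  continuous f -> continuous g ->
  (forall x : R, is_derive x 1 G (f x - g x)) ->
  (forall n, `|G n.+1%:R| <= C / n.+1%:R /\ `|G (- n.+1%:R)| <= C / n.+1%:R) ->
  (\int[lebesgue_measure]_x (g x)%:E = I%:E)%E ->
  (\int[lebesgue_measure]_x (f x)%:E = I%:E)%E.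
Proof.
move=> f0 g0 cf cg dG bG gI.
pose F (n : nat) : set R := `[- n.+1%:R, n.+1%:R]%classic.
have cvgF (h : R -> R) : (forall x, 0 <= h x) -> continuous h ->
    (\int[lebesgue_measure]_(x in F n) (h x)%:E @[n --> \oo] -->
     \int[lebesgue_measure]_x (h x)%:E)%E.
  move=> h0 ch; rewrite -bigcup_sym_itv.
  apply: ge0_nondecreasing_set_cvg_integral.
  - move=> m n mn; apply/subsetPset => x; rewrite /F/= !in_itv/= => /andP[x1 x2].
    have mn' : m.+1%:R <= n.+1%:R :> R by rewrite ler_nat.
    by rewrite (le_trans _ x1) ?lerN2//= (le_trans x2).
  - by move=> i; exact: measurable_itv.
  - move=> i; apply: measurable_funTS; apply/measurable_EFinP.
    exact: continuous_measurable_fun.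
  - by move=> i x _; rewrite lee_fin.
have mF n : measurable (F n : set (measurableTypeR R)) by exact: measurable_itv.
have intF (h : R -> R) (n : nat) : continuous h ->
    lebesgue_measure.-integrable (F n) (EFin \o h).
  move=> ch; apply: continuous_compact_integrable; first exact: segment_compact.
  exact: continuous_subspaceT.
have cG : continuous G.
  move=> x; apply: differentiable_continuous; apply/derivable1_diffP.
  by have [] := dG x.
have eqF n : (\int[lebesgue_measure]_(x in F n) (f x)%:E =
    \int[lebesgue_measure]_(x in F n) (g x)%:E +
    (G n.+1%:R - G (- n.+1%:R))%:E)%E.
  have := @continuous_FTC2 R (f \- g) G (- n.+1%:R) n.+1%:R.
  rewrite -/(F n) => FTC2.
  have := @integralB _ _ _ lebesgue_measure (F n) (mF n) _ _
    (intF _ n cf) (intF _ n cg).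
  rewrite [X in X = _](_ : _ = (G n.+1%:R)%:E - (G (- n.+1%:R))%:E)%E; last first.
    rewrite -FTC2.
    - by apply: eq_integral => x _; rewrite /= EFinB.
    - by rewrite gtrN// ltr0n.
    - apply: continuous_subspaceT => x; apply: cvgB; [exact: cf|exact: cg].
    - split.
      + by move=> x _; have [] := dG x.
      + by apply: cvg_at_right_filter; exact: cG.
      + by apply: cvg_at_left_filter; exact: cG.
    - by move=> x _; rewrite derive1E; have [] := dG x.
  (* Both truncated integrals are finite, so the identity in the extended reals can be solved for
     the integral of [f]. *)
  have := integral_fune_fin_num (mF n) (intF _ n cg).
  have := integral_fune_fin_num (mF n) (intF _ n cf).
  rewrite /comp.
  move=> /fineK <- /fineK <-; rewrite -EFinB -EFinB => -[->].
  by rewrite -EFinD; congr EFin; ring.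
apply: cvg_unique (cvgF f f0 cf) _ => //.
rewrite /= [X in X @ _](funext eqF) -[I%:E]adde0; apply: cvgeD => //.
  by rewrite -gI; exact: (cvgF g).
apply: cvg_EFin; first by near=> n.
rewrite /comp/=.
apply: (@harmonic_bound_cvg0 _ _ (2 * C)) => n.
rewrite (le_trans (ler_normB _ _))// mulr2n mulrDl mul1r mulrDl.
by have [b1 b2] := bG n; exact: lerD.
Unshelve. all: by end_near. Qed.

Lemma is_derive_normal_pdf (R : realType) (s x : R) : s != 0 ->
  is_derive x 1 (normal_pdf 0 s : R -> R) (- x / s ^+ 2 * normal_pdf 0 s x).
Proof.
move=> s0; rewrite /normal_pdf (negbTE s0) /normal_fun.
have -> : (fun x0 : R => normal_peak s * expR (- (x0 - 0) ^+ 2 / (s ^+ 2 *+ 2))) =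
    (fun x0 => normal_peak s * (expR \o (fun x0 : R => - (s ^+ 2 *+ 2)^-1 * (x0 * x0))) x0).
  by apply/funext => y/=; rewrite subr0 expr2 !mulNr [_ / _]mulrC.
have H : is_derive x 1 (fun x0 : R => - (s ^+ 2 *+ 2)^-1 * (x0 * x0))
   (- (s ^+ 2 *+ 2)^-1 * (x + x)).
  have D := is_deriveM (is_derive_id x (1 : R)) (is_derive_id x (1 : R)).
  apply: (is_derive_eq (is_deriveZ (- (s ^+ 2 *+ 2)^-1) D)).
  by rewrite /GRing.scale/= !mulr1.
apply: (is_derive_eq (is_deriveZ (normal_peak s) (is_derive1_comp _ H))).
rewrite /GRing.scale/= subr0.
have -> : - x ^+ 2 / (s ^+ 2 *+ 2) = - (s ^+ 2 *+ 2)^-1 * (x * x).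
  by rewrite expr2 !mulNr mulrC.
by field.
Qed.

(** From exp y >= y^2 / 2 at y = x^2 / (2 s^2). Quartic decay is enough: a boundary term with a
    power of x up to the third still decays like 1 / |x|. *)
Lemma normal_pdf_tail (R : realType) (s x : R) : s != 0 -> x != 0 ->
  normal_pdf 0 s x <= normal_peak s * (8 * s ^+ 4 / x ^+ 4).
Proof.
move=> s0 x0; rewrite /normal_pdf (negbTE s0) ler_wpM2l ?normal_peak_ge0//.
rewrite /normal_fun subr0 mulNr expRN.
have y0 : 0 < x ^+ 2 / (s ^+ 2 *+ 2).
  by rewrite divr_gt0 ?pmulrn_rgt0// exprn_even_gt0.
have := @expR_ge1Dxn R _ 1 (ltW y0).
set y := x ^+ 2 / _ => yE.
have -> : 8 * s ^+ 4 / x ^+ 4 = (y ^+ 2 / 2)^-1 by rewrite /y; field; rewrite s0 x0.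
rewrite lef_pV2 ?posrE ?expR_gt0 ?divr_gt0 ?exprn_gt0//.
apply: le_trans yE; rewrite lerDr//.
Qed.

(** Integration by parts: the derivative of - s^2 x^(k+1) phi(x) is x^(k+2) phi(x) - (k+1) s^2 x^k
    phi(x). Evenness of [k] makes both integrands nonnegative, and [k <= 2] lets [normal_pdf_tail]
    control the boundary term. *)
Lemma normal_moment_step (R : realType) (s I : R) (k : nat) :
  s != 0 -> ~~ odd k -> (k <= 2)%N ->
  (\int[lebesgue_measure]_x (x ^+ k * normal_pdf 0 s x)%:E = I%:E)%E ->
  (\int[lebesgue_measure]_x (x ^+ k.+2 * normal_pdf 0 s x)%:E =
   (k.+1%:R * s ^+ 2 * I)%:E)%E.
Proof.
move=> s0 ek k2 Ik.
have xk_ge0 j (x : R) : ~~ odd j -> 0 <= x ^+ j by move=> ej; rewrite exprn_even_ge0.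
have cpdf : continuous (normal_pdf 0 s) by exact: continuous_normal_pdf.
have cX j : continuous (fun x : R => x ^+ j * normal_pdf 0 s x).
  by move=> x; apply: cvgM; [exact: exprn_continuous|exact: cpdf].
pose G (x : R) := - s ^+ 2 * (x ^+ k.+1 * normal_pdf 0 s x).
have bG (y : R) : 1 <= `|y| -> `|G y| <= 8 * s ^+ 6 * normal_peak s / `|y|.
  move=> y1; have y0 : y != 0 by rewrite -normr_gt0 (lt_le_trans _ y1).
  rewrite /G mulNr normrN [leLHS]normrM [X in _ * X]normrM normrX.
  rewrite real_normK ?num_real// [`|y ^+ k.+1|]normrX.
  rewrite [`|normal_pdf 0 s y|]ger0_norm ?normal_pdf_ge0//.
  have yk : `|y| ^+ k.+1 <= `|y| ^+ 3 by rewrite ler_weXn2l.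
  have := normal_pdf_tail s0 y0; have : 0 <= normal_pdf 0 s y by exact: normal_pdf_ge0.
  set f := normal_pdf _ _ _ => f0 fy.
  apply: (@le_trans _ _ (s ^+ 2 * (`|y| ^+ 3 *
     (normal_peak s * (8 * s ^+ 4 / y ^+ 4))))).
    by rewrite ler_wpM2l ?sqr_ge0// ler_pM ?exprn_ge0.
  rewrite -[y ^+ 4](@ger0_norm _ (y ^+ 4)) ?exprn_even_ge0// normrX.
  rewrite le_eqVlt; apply/orP; left; apply/eqP; field.
  by rewrite normr_eq0 y0.
apply: (@integral_eq_boundary0 _ _ (fun x => k.+1%:R * s ^+ 2 * (x ^+ k * normal_pdf 0 s x))
  G (8 * s ^+ 6 * normal_peak s)).
- by move=> x; rewrite mulr_ge0 ?normal_pdf_ge0 ?xk_ge0//= negbK.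
- move=> x; apply: mulr_ge0; first by rewrite mulr_ge0 ?sqr_ge0.
  by rewrite mulr_ge0 ?normal_pdf_ge0 ?xk_ge0.
- exact: cX.
- by move=> x; apply: cvgM; [exact: cvg_cst|exact: cX].
- move=> x.
  have D := is_deriveM (is_deriveX k.+1 (is_derive_id x (1 : R))) (is_derive_normal_pdf x s0).
  have -> : G = - s ^+ 2 \*: (id ^+ k.+1 * normal_pdf 0 s).
    by apply/funext => y; rewrite /G/= exprfctE.
  apply: (is_derive_eq (is_deriveZ (- s ^+ 2) D)).
  rewrite exprfctE /GRing.scale/= !exprS; field.
  exact: s0.
- move=> n; have n1 : 1 <= n.+1%:R :> R by rewrite ler1n.
  have nE : `|n.+1%:R| = n.+1%:R :> R by rewrite ger0_norm.
  split; first by rewrite -[X in _ <= _ / X]nE bG// nE.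
  by rewrite -[X in _ <= _ / X]nE -[X in _ / X]normrN bG// normrN nE.
- under eq_integral do rewrite EFinM.
  rewrite ge0_integralZl//; last 3 first.
  + apply/measurable_EFinP.
    exact: (continuous_measurable_fun (cX k)).
  + by move=> x _; rewrite lee_fin mulr_ge0 ?normal_pdf_ge0 ?xk_ge0.
  + by rewrite lee_fin mulr_ge0 ?sqr_ge0.
  by rewrite Ik.
Qed.

Lemma normal_moment2 (R : realType) (s : R) : s != 0 ->
  (\int[lebesgue_measure]_x (x ^+ 2 * normal_pdf 0 s x)%:E = (s ^+ 2)%:E)%E.
Proof.
move=> s0; rewrite (@normal_moment_step _ _ 1 0)//; first by rewrite mul1r mulr1.
by under eq_integral do rewrite expr0 mul1r; exact: integral_normal_pdf.
Qed.

Lemma normal_moment4 (R : realType) (s : R) : s != 0 ->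
  (\int[lebesgue_measure]_x (x ^+ 4 * normal_pdf 0 s x)%:E =
   (3 * s ^+ 2 ^+ 2)%:E)%E.
Proof.
move=> s0; rewrite (@normal_moment_step _ _ _ 2 s0 _ _ (normal_moment2 s0))//.
by rewrite -mulrA -expr2.
Qed.

(** Integrability travels with the value, so that means of finite linear combinations can be
    composed without side conditions. *)
Definition has_mean (R : realType) (d : measure_display) (T : measurableType d)
    (P : probability T R) (f : T -> R) (m : R) : Prop :=
  P.-integrable [set: T] (EFin \o f) /\ (\int[P]_w (f w)%:E = m%:E)%E.

Lemma has_mean_eq (R : realType) (d : measure_display) (T : measurableType d)
    (P : probability T R) (f g : T -> R) (m l : R) :
  f =1 g -> m = l -> has_mean P f m -> has_mean P g l.
Proof. by move=> /funext -> ->. Qed.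

Lemma has_meanD (R : realType) (d : measure_display) (T : measurableType d)
    (P : probability T R) (f g : T -> R) (m l : R) :
  has_mean P f m -> has_mean P g l -> has_mean P (fun w => f w + g w) (m + l).
Proof.
move=> [fi fm] [gi gm]; split.
  by have := integrableD measurableT fi gi; apply: eq_integrable.
by rewrite EFinD -fm -gm -integralD.
Qed.

Lemma has_meanZ (R : realType) (d : measure_display) (T : measurableType d)
    (P : probability T R) (f : T -> R) (m a : R) :
  has_mean P f m -> has_mean P (fun w => a * f w) (a * m).
Proof.
move=> [fi fm]; split.
  by have := integrableZl measurableT a fi; apply: eq_integrable.
by rewrite EFinM -fm -integralZl.
Qed.

Lemma has_mean0 (R : realType) (d : measure_display) (T : measurableType d)
    (P : probability T R) : has_mean P (fun=> 0) 0.
Proof. by split; [exact: integrable0|exact: integral0]. Qed.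

Lemma has_mean_cst (R : realType) (d : measure_display) (T : measurableType d)
    (P : probability T R) (m : R) : has_mean P (fun=> m) m.
Proof.
split; first exact: finite_measure_integrable_cst.
by rewrite integral_cst// [X in (_ * X)%E]probability_setT mule1.
Qed.

Lemma has_mean_sum (R : realType) (d : measure_display) (T : measurableType d)
    (P : probability T R) (I : Type) (r : seq I) (f : I -> T -> R) (m : I -> R) :
  (forall i, has_mean P (f i) (m i)) ->
  has_mean P (fun w => \sum_(i <- r) f i w) (\sum_(i <- r) m i).
Proof.
move=> fm; elim: r => [|i r IH].
  by apply: has_mean_eq (has_mean0 P) => [w|]; rewrite big_nil.
by apply: has_mean_eq (has_meanD (fm i) IH) => [w|]; rewrite big_cons.
Qed.

Lemma markov_has_mean (R : realType) (d : measure_display) (T : measurableType d)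
    (P : probability T R) (f : T -> R) (m t : R) (A : set T) :
  (forall w, 0 <= f w) -> 0 < t -> has_mean P f m -> measurable A ->
  (forall w, A w -> t <= f w) -> (P A <= (m / t)%:E)%E.
Proof.
move=> f0 t0 [fi fm] mA Af.
have mf := measurable_int _ fi.
rewrite EFinM lee_pdivlMr// muleC -[in leRHS]fm.
rewrite -[leLHS](_ : (\int[P]_(x in A) t%:E = _)%E); last first.
  by rewrite integral_cst.
apply: (@le_trans _ _ (\int[P]_(x in A) (f x)%:E)%E).
  apply: ge0_le_integral => //.
  - by move=> w _; rewrite lee_fin ltW.
  - exact: measurable_funTS.
apply: ge0_subset_integral => // w _; rewrite /= lee_fin; exact: f0.
Qed.

Lemma gaussian_moments (R : realType) (d : measure_display) (T : measurableType d)
    (P : probability T R) (Z : T -> R) (s2 : R) :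
  0 <= s2 -> has_law P Z (gaussian 0 s2) ->
  has_mean P (fun w => Z w ^+ 2) s2 /\ has_mean P (fun w => Z w ^+ 4) (3 * s2 ^+ 2).
Proof.
move=> s2_ge0 [mZ lawZ].
pose PZ := measure_function_pushforward__canonical__measure_function_Measure P
  (mZ : @measurable_fun _ _ T (measurableTypeR R) setT Z).
have pushE k : ~~ odd k -> (\int[P]_w (Z w ^+ k)%:E =
    \int[PZ]_x (x ^+ k)%:E)%E.
  move=> ek; rewrite ge0_integral_pushforward//.
  - apply/measurable_EFinP; exact: exprn_measurable.
  - by move=> x _; rewrite lee_fin exprn_even_ge0.
have mean k m : ~~ odd k -> (\int[P]_w (Z w ^+ k)%:E = m%:E)%E ->
    has_mean P (fun w => Z w ^+ k) m.
  move=> ek km; split => //; apply/integrableP; split.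
    by apply/measurable_EFinP; exact: measurable_funX.
  under eq_integral => x _.
    rewrite gee0_abs ?lee_fin ?exprn_even_ge0//; over.
  by rewrite km ltry.
(* Zero variance does occur: with repeated indices, a linear form used for polarisation can vanish
   identically. The law is then a point mass and has no density. *)
have [s20|s20] := eqVneq s2 0.
  have zero k : ~~ odd k -> (0 < k)%N -> has_mean P (fun w => Z w ^+ k) 0.
    move=> ek k0; apply: mean => //; rewrite pushE//.
    transitivity (\int[dirac (0%R : measurableTypeR R)]_x (x ^+ k)%:E)%E.
      apply: eq_measure_integral => A mA _.
      by have := lawZ A mA; rewrite /gaussian s20 eqxx.
    rewrite integral_dirac// ?diracT ?mul1e ?expr0n ?(gtn_eqF k0)//.
    by apply/measurable_EFinP; exact: exprn_measurable.
  by rewrite s20 expr0n mulr0; split; exact: zero.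
have s0 : Num.sqrt s2 != 0 by rewrite sqrtr_eq0 -ltNge lt_neqAle eq_sym s20.
have sE : Num.sqrt s2 ^+ 2 = s2 by rewrite sqr_sqrtr.
have normE k : ~~ odd k -> (\int[P]_w (Z w ^+ k)%:E =
    \int[lebesgue_measure]_x (x ^+ k * normal_pdf 0 (Num.sqrt s2) x)%:E)%E.
  move=> ek; rewrite pushE//.
  transitivity (\int[normal_prob 0 (Num.sqrt s2)]_x (x ^+ k)%:E)%E.
    apply: eq_measure_integral => A mA _.
    by have := lawZ A mA; rewrite /gaussian (negbTE s20).
  rewrite (@ge0_integral_normal_prob R 0 _ (fun x => x ^+ k))//.
  by move=> x; rewrite exprn_even_ge0.
split; apply: mean => //; rewrite normE//.
  by rewrite normal_moment2// sE.
by rewrite normal_moment4// sE.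
Qed.

(** * Symmetric matrices and their leading eigenvectors *)

Definition quad (R : realType) (m : nat) (A : 'M[R]_m) (v : 'cV[R]_m) : R :=
  (v^T *m A *m v) 0 0.

(** The squared Frobenius norm: unlike the operator norm, its expectation is a sum of moments of
    entries. *)
Definition sqnorm (R : realType) (m n : nat) (A : 'M[R]_(m, n)) : R :=
  \sum_i \sum_j A i j ^+ 2.

Lemma quadE (R : realType) (m : nat) (A : 'M[R]_m) (v : 'cV[R]_m) :
  quad A v = \sum_i \sum_j A i j * (v i 0 * v j 0).
Proof.
rewrite /quad !mxE exchange_big; apply: eq_bigr => j _ /=.
rewrite mxE big_distrl; apply: eq_bigr => i _ /=.
rewrite !mxE; ring.
Qed.

Lemma quadDl (R : realType) (m : nat) (A B : 'M[R]_m) (v : 'cV[R]_m) :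
  quad (A + B) v = quad A v + quad B v.
Proof. by rewrite /quad mulmxDr mulmxDl mxE. Qed.

Lemma quadZl (R : realType) (m : nat) (a : R) (A : 'M[R]_m) (v : 'cV[R]_m) :
  quad (a *: A) v = a * quad A v.
Proof. by rewrite /quad -scalemxAr -scalemxAl mxE. Qed.

Lemma quadZr (R : realType) (m : nat) (a : R) (A : 'M[R]_m) (v : 'cV[R]_m) :
  quad A (a *: v) = a ^+ 2 * quad A v.
Proof.
by rewrite !quadE mulr_sumr; apply: eq_bigr => i _; rewrite mulr_sumr;
  apply: eq_bigr => j _; rewrite !mxE; ring.
Qed.

Lemma dotC (R : realType) (m : nat) (u v : 'cV[R]_m) :
  (u^T *m v) 0 0 = (v^T *m u) 0 0.
Proof. by rewrite !mxE; apply: eq_bigr => i _; rewrite !mxE mulrC. Qed.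

Lemma enorm_ge0 (R : realType) (m : nat) (v : 'cV[R]_m) : 0 <= enorm v.
Proof. exact: sqrtr_ge0. Qed.

Lemma sqr_enorm (R : realType) (m : nat) (v : 'cV[R]_m) :
  enorm v ^+ 2 = (v^T *m v) 0 0.
Proof.
rewrite sqr_sqrtr ?sumr_ge0// => [|i _]; last exact: sqr_ge0.
by rewrite mxE; apply: eq_bigr => i _; rewrite mxE.
Qed.

Lemma dot_eq0 (R : realType) (m : nat) (v : 'cV[R]_m) :
  (v^T *m v) 0 0 = 0 -> v = 0.
Proof.
rewrite mxE => /eqP; rewrite psumr_eq0 => [/allP v0|i _]; last first.
  by rewrite mxE -expr2 sqr_ge0.
apply/matrixP => i j; rewrite ord1 [RHS]mxE.
have := v0 i (mem_index_enum _); rewrite /= mxE -expr2 sqrf_eq0.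
by move/eqP.
Qed.

Lemma quad_outer (R : realType) (m : nat) (g v : 'cV[R]_m) :
  quad (g *m g^T) v = (v^T *m g) 0 0 ^+ 2.
Proof.
rewrite /quad mulmxA -mulmxA mxE big_ord1 expr2; congr (_ * _).
by rewrite dotC.
Qed.

Lemma quad_scalar (R : realType) (m : nat) (a : R) (v : 'cV[R]_m) :
  quad a%:M v = a * (v^T *m v) 0 0.
Proof. by rewrite /quad -scalemx1 -scalemxAr mulmx1 -scalemxAl mxE. Qed.

Lemma quad_eigen (R : realType) (m : nat) (A : 'M[R]_m) (v : 'cV[R]_m) (l : R) :
  A *m v = l *: v -> quad A v = l * (v^T *m v) 0 0.
Proof. by move=> Av; rewrite /quad -mulmxA Av -scalemxAr mxE. Qed.

Lemma cauchy_schwarz_sum (R : realType) (I : finType) (a b : I -> R) :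
  (\sum_i a i * b i) ^+ 2 <= (\sum_i a i ^+ 2) * (\sum_i b i ^+ 2).
Proof.
have -> : (\sum_i a i * b i) ^+ 2 = \sum_i \sum_j (a i * b i) * (a j * b j).
  by rewrite expr2 big_distrlr.
have -> : (\sum_i a i ^+ 2) * (\sum_i b i ^+ 2) = \sum_i \sum_j a i ^+ 2 * b j ^+ 2.
  by rewrite big_distrlr.
have E : \sum_i \sum_j a i ^+ 2 * b j ^+ 2 = \sum_i \sum_j a j ^+ 2 * b i ^+ 2.
  by rewrite exchange_big.
rewrite -(ler_pM2l (ltr0Sn R 1)) !mulr_natl [X in _ <= X]mulr2n [in X in _ <= _ + X]E.
rewrite -big_split/= -sumrMnl ler_sum// => i _.
rewrite -big_split/= -sumrMnl ler_sum// => j _.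
rewrite -subr_ge0.
have -> : a i ^+ 2 * b j ^+ 2 + a j ^+ 2 * b i ^+ 2 - (a i * b i * (a j * b j)) *+ 2 =
   (a i * b j - a j * b i) ^+ 2 by ring.
exact: sqr_ge0.
Qed.

Lemma cauchy_schwarz_mx (R : realType) (m n : nat) (A B : 'M[R]_(m, n)) :
  (\sum_i \sum_j A i j * B i j) ^+ 2 <= sqnorm A * sqnorm B.
Proof.
rewrite /sqnorm !pair_big/=.
exact: (cauchy_schwarz_sum (fun k => A k.1 k.2) (fun k => B k.1 k.2)).
Qed.

(** Phrased on row vectors to fit [EVT_max_rV], which [rayleigh] applies on the unit sphere. *)
Lemma continuous_quad (R : realType) (m : nat) (A : 'M[R]_m) :
  continuous (fun v : 'rV[R]_m => quad A v^T).
Proof.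
have -> : (fun v : 'rV[R]_m => quad A v^T) =
    fun v => \sum_(k : 'I_m * 'I_m) A k.1 k.2 * (v 0 k.1 * v 0 k.2).
  apply/funext => u; rewrite quadE pair_big; apply: eq_bigr => -[i j] _.
  by rewrite !mxE.
apply: continuous_big => // [|k _ v]; first exact: add_continuous.
have cM : {for v, continuous (fun x : 'rV[R]_m => x 0 k.1 * x 0 k.2)}.
  by apply: continuousM; exact: coord_continuous.
exact: (continuousM (@cst_continuous _ _ (A k.1 k.2) v) cM).
Qed.

(** If B u were nonzero, a small step from [u] in the direction - B u would make the form negative,
    since the first-order term dominates. *)
Lemma psd_kernel (R : realType) (m : nat) (B : 'M[R]_m) (u : 'cV[R]_m) :
  B^T = B -> (forall v, 0 <= quad B v) -> quad B u = 0 -> B *m u = 0.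
Proof.
move=> Bs B0 Bu; apply: dot_eq0; set w := B *m u.
have Buw t : quad B (u + t *: w) = 2 * t * (w^T *m w) 0 0 + t ^+ 2 * quad B w.
  have E1 : (u + t *: w)^T = u^T + t *: w^T by rewrite linearD linearZ.
  rewrite /quad E1 !mulmxDl !mulmxDr.
  rewrite -!(mulmxA _ B u) -/w.
  have -> : u^T *m B = w^T by rewrite /w trmx_mul Bs.
  rewrite -!scalemxAl -!scalemxAr !mxE.
  have := Bu; rewrite /quad -mulmxA -/w => E.
  have -> : (\sum_j u^T 0 j * w j 0) = 0 by rewrite -[RHS]E mxE.
  ring.
set a : R := (w^T *m w) 0 0 in Buw *; set b : R := quad B w in Buw.
have a0 : 0 <= a by rewrite /a -sqr_enorm sqr_ge0.
have b0 : 0 <= b by exact: B0.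
apply/eqP; rewrite eq_le a0 andbT leNgt; apply/negP => agt0.
(* The ideal step is - a / b; the 1 in the denominator covers b = 0 and still gives a negative
   value. *)
have := B0 (u + (- a / (b + 1)) *: w); rewrite Buw.
have -> : 2 * (- a / (b + 1)) * a + (- a / (b + 1)) ^+ 2 * b =
   - (a ^+ 2 * (b + 2) / (b + 1) ^+ 2) by field; rewrite gt_eqF// ltr_wpDl.
rewrite oppr_ge0 leNgt => /negP; apply.
by rewrite divr_gt0 ?mulr_gt0 ?exprn_gt0// ltr_wpDl.
Qed.

(* A maximiser of the quadratic form on the compact unit sphere is an eigenvector. *)
Lemma rayleigh (R : realType) (m : nat) (A : 'M[R]_m) (l : R) (v : 'cV[R]_m) :
  A^T = A -> (forall l', eigenvalue A l' -> l' <= l) ->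
  quad A v <= l * (v^T *m v) 0 0.
Proof.
move=> As lmax.
have [->|v0] := eqVneq v 0.
  by rewrite /quad trmx0 !mul0mx mxE mulr0.
have normv (x : 'cV[R]_m) : x != 0 -> 0 < (x^T *m x) 0 0.
  move=> x0; rewrite lt_neqAle -sqr_enorm sqr_ge0 andbT eq_sym.
  by apply: contra x0; rewrite sqr_enorm => /eqP/dot_eq0/eqP.
(* The unit sphere is written as a level set of a quadratic form, so that [continuous_quad] shows it
   to be closed. *)
pose K : set 'rV[R]_m := [set x | quad 1%:M x^T = 1].
have unitK (x : 'cV[R]_m) : x != 0 -> K ((enorm x)^-1 *: x)^T.
  move=> x0; rewrite /K/= trmxK quadZr quad_scalar mul1r exprVn sqr_enorm.
  by rewrite mulVf// gt_eqF// normv.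
have cK : compact K.
  apply: bounded_closed_compact.
  - exists 1; split => // M M1 x /= Kx.
    apply: le_trans (ltW M1); rewrite [leLHS]mx_normrE.
    apply: bigmax_le => // -[i j] _ /=; rewrite (ord1 i).
    rewrite -(@expr_le1 _ 2)// real_normK ?num_real// -Kx quad_scalar mul1r mxE.
    rewrite (bigD1 j)//= !mxE -expr2 lerDl sumr_ge0// => k _.
    by rewrite !mxE -expr2 sqr_ge0.
  - have -> : K = (fun x : 'rV[R]_m => quad 1%:M x^T) @^-1` [set 1].
      by apply/seteqP; split.
    apply: closed_comp; last exact: closed_eq.
    by move=> x _; exact: continuous_quad.
have [||c cK' cmax] := @EVT_max_rV R m (fun x => quad A x^T) K _ cK.
- by exists ((enorm v)^-1 *: v)^T; exact: unitK.
- by apply: continuous_subspaceT; exact: continuous_quad.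
set mu := quad A c^T in cmax.
have c1 : (c^T^T *m c^T) 0 0 = 1.
  by have := cK'; rewrite inE /K/= quad_scalar mul1r.
have ray (x : 'cV[R]_m) : quad A x <= mu * (x^T *m x) 0 0.
  have [->|x0] := eqVneq x 0.
    by rewrite /quad trmx0 !mul0mx mxE mulr0.
  have := cmax ((enorm x)^-1 *: x)^T; rewrite inE => /(_ (unitK x x0)).
  rewrite trmxK quadZr exprVn sqr_enorm mulrC ler_pdivrMr//; exact: normv.
(* mu I - A is positive semidefinite by [ray], and its form vanishes at the maximiser. *)
have Acmu : A *m c^T = mu *: c^T.
  apply/eqP; rewrite -subr_eq0 -opprB oppr_eq0 -mul_scalar_mx -mulmxBl; apply/eqP.
  apply: psd_kernel.
  - by rewrite linearB/= tr_scalar_mx As.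
  - by move=> x; rewrite quadDl -scaleN1r quadZl mulN1r quad_scalar subr_ge0.
  - by rewrite quadDl -scaleN1r quadZl mulN1r quad_scalar c1 mulr1 subrr.
have emu : eigenvalue A mu.
  apply/eigenvalueP; exists c.
    by apply: trmx_inj; rewrite trmx_mul linearZ/= As.
  apply/eqP => c0; move: c1; rewrite c0 trmx0 mulmx0 mxE => /eqP.
  by rewrite eq_sym oner_eq0.
apply: le_trans (ray v) _; rewrite ler_wpM2r ?lmax//.
by rewrite -sqr_enorm sqr_ge0.
Qed.

(** The matrix determinant lemma, free of division so that it can be used over polynomials. The
    bordered matrix [B] is evaluated twice: by a block triangular factorisation, and by clearing its
    lower left block. *)
Lemma det_scalar_add_outer (R : comNzRingType) (m : nat) (x : R) (u v : 'cV[R]_m) :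
  \det (x%:M + u *m v^T) * x = (x + (v^T *m u) 0 0) * x ^+ m.
Proof.
pose B : 'M[R]_(1 + m) := block_mx 1%:M (- v^T) u x%:M.
have E1 : block_mx 1%:M 0 u 1%:M *m block_mx 1%:M (- v^T) 0 (x%:M + u *m v^T) = B.
  rewrite mulmx_block !mul1mx !mulmx1 !mul0mx !addr0.
  by rewrite mulmxN addrCA addNr addr0.
have E2 : B *m block_mx x%:M 0 (- u) 1%:M = block_mx (x%:M + v^T *m u) (- v^T) 0 x%:M.
  rewrite mulmx_block !mul1mx !mulmx1 !mulmx0 !add0r mulmxN mulNmx opprK.
  by rewrite mul_mx_scalar mulmxN mul_scalar_mx subrr.
have D1 : \det B = \det (x%:M + u *m v^T).
  by rewrite -E1 det_mulmx det_lblock det_ublock !det1 !mul1r.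
have := congr1 determinant E2; rewrite det_mulmx D1 det_lblock det_ublock.
rewrite det1 mulr1 det_scalar1 det_scalar => ->.
by rewrite [x%:M + _]mx11_scalar det_scalar1 !mxE.
Qed.

(** Deflation moves one root from [l] to [l - d] and keeps the others. As X I - A acts on [g] as
    multiplication by X - l, it can be factored out of (X - l) times the deflated characteristic
    matrix, leaving a scalar matrix plus an outer product. *)
Lemma char_poly_deflate (R : realType) (m : nat) (A : 'M[R]_m) (g : 'cV[R]_m)
    (l d : R) :
  A *m g = l *: g -> (g^T *m g) 0 0 = 1 ->
  char_poly (A - d *: (g *m g^T)) * ('X - l%:P) = char_poly A * ('X - (l - d)%:P).
Proof.
move=> Ag g1.
pose h : 'cV[{poly R}]_m := map_mx polyC g.
pose C := char_poly_mx A.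
have Ch : C *m h = ('X - l%:P) *: h.
  rewrite /C /char_poly_mx mulmxBl mul_scalar_mx -map_mxM Ag map_mxZ.
  by rewrite scalerBl.
have h1 : (h^T *m h) 0 0 = 1.
  by rewrite map_trmx -map_mxM mxE g1.
have E : ('X - l%:P) *: char_poly_mx (A - d *: (g *m g^T)) =
    C *m (('X - l%:P)%:M + (d%:P *: h) *m h^T).
  rewrite mulmxDr mul_mx_scalar -scalemxAl -scalemxAr mulmxA Ch -scalemxAl scalerA.
  rewrite [_ * ('X - _)]mulrC -scalerA -scalerDr; congr (_ *: _).
  rewrite /C /char_poly_mx map_mxB map_mxZ map_mxM map_trmx.
  by rewrite opprB addrCA addrC.
have X0 : ('X - l%:P) ^+ m != 0 :> {poly R} by rewrite expf_neq0// polyXsubC_eq0.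
apply: (mulfI X0); rewrite mulrA -[_ ^+ m * char_poly _]detZ E det_mulmx.
rewrite -mulrA det_scalar_add_outer -scalemxAr mxE h1 mulr1.
rewrite polyCB /char_poly -/C; ring.
Qed.

Lemma sqnorm_ge0 (R : realType) (m n : nat) (A : 'M[R]_(m, n)) : 0 <= sqnorm A.
Proof. by rewrite sumr_ge0// => i _; rewrite sumr_ge0// => j _; rewrite sqr_ge0. Qed.

Lemma sqnorm_outer (R : realType) (m : nat) (u v : 'cV[R]_m) :
  sqnorm (u *m v^T) = (u^T *m u) 0 0 * (v^T *m v) 0 0.
Proof.
rewrite /sqnorm !mxE big_distrlr; apply: eq_bigr => i _; apply: eq_bigr => j _.
rewrite !mxE big_ord1 !mxE /=; ring.
Qed.

(** For unit vectors this is twice the squared sine of the angle; its nonnegativity then gives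
    (u'v)^2 <= 1. *)
Lemma sqnorm_sub_outer (R : realType) (m : nat) (u v : 'cV[R]_m) :
  sqnorm (u *m u^T - v *m v^T) =
  (u^T *m u) 0 0 ^+ 2 + (v^T *m v) 0 0 ^+ 2 - 2 * (u^T *m v) 0 0 ^+ 2.
Proof.
rewrite /sqnorm !mxE !expr2 !big_distrlr/= mulr_sumr -big_split -sumrB/=.
apply: eq_bigr => i _; rewrite mulr_sumr -big_split -sumrB/=.
apply: eq_bigr => j _; rewrite !mxE !big_ord1 !mxE; ring.
Qed.

Lemma posdef_quad_ge0 (R : realType) (m : nat) (A : 'M[R]_m) (v : 'cV[R]_m) :
  posdef A -> 0 <= quad A v.
Proof.
move=> [_ A0]; have [->|v0] := eqVneq v 0.
  by rewrite /quad trmx0 !mul0mx mxE.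
exact/ltW/A0.
Qed.

(** At the vector - A_ij e_i + A_ii e_j the form equals A_ii times the 2 x 2 minor, and A_ii > 0. *)
Lemma posdef_entry (R : realType) (m : nat) (A : 'M[R]_m) (i j : 'I_m) :
  posdef A -> A i j ^+ 2 <= A i i * A j j.
Proof.
move=> Apd; have [As A0] := Apd.
have Asym k l : A l k = A k l by rewrite -[in LHS]As mxE.
have bil (x y : R) : quad A (x *: delta_mx i 0 + y *: delta_mx j 0) =
    x ^+ 2 * A i i + 2 * x * y * A i j + y ^+ 2 * A j j.
  have D k l : ((delta_mx k 0 : 'cV[R]_m)^T *m A *m (delta_mx l 0 : 'cV[R]_m)) 0 0 = A k l.
    by rewrite trmx_delta -rowE -colE !mxE.
  have E1 : (x *: delta_mx i 0 + y *: delta_mx j 0 : 'cV[R]_m)^T =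
     x *: (delta_mx i 0)^T + y *: (delta_mx j 0)^T by rewrite linearD !linearZ.
  rewrite /quad E1 !mulmxDl !mulmxDr -!scalemxAl -!scalemxAr.
  have SE (M N : 'M[R]_1) : (M + N) 0 0 = M 0 0 + N 0 0 by rewrite mxE.
  have ZE (c : R) (N : 'M[R]_1) : (c *: N) 0 0 = c * N 0 0 by rewrite mxE.
  rewrite !SE !ZE !D (Asym i j); ring.
have Aii : 0 < A i i.
  have := A0 (delta_mx i 0); rewrite trmx_delta -rowE -colE !mxE; apply.
  apply/eqP => /matrixP/(_ i 0); rewrite !mxE !eqxx => /eqP.
  by rewrite oner_eq0.
have := posdef_quad_ge0 ((- A i j) *: delta_mx i 0 + A i i *: delta_mx j 0) Apd.
rewrite bil.
have -> : (- A i j) ^+ 2 * A i i + 2 * (- A i j) * A i i * A i j + A i i ^+ 2 * A j j =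
  A i i * (A i i * A j j - A i j ^+ 2) by ring.
by rewrite pmulr_rge0// subr_ge0.
Qed.

Lemma posdef_sqnorm_le (R : realType) (m : nat) (A : 'M[R]_m) :
  posdef A -> sqnorm A <= \tr A ^+ 2.
Proof.
move=> Apd; rewrite /mxtrace expr2 big_distrlr ler_sum// => i _.
by rewrite ler_sum// => j _; exact: posdef_entry.
Qed.

Lemma sym_tr_sqr (R : realType) (m : nat) (A : 'M[R]_m) :
  A^T = A -> \tr (A *m A) = sqnorm A.
Proof.
move=> As; apply: eq_bigr => i _; rewrite mxE; apply: eq_bigr => j _.
by rewrite expr2; congr (_ * _); rewrite -[in LHS]As mxE.
Qed.

(** The eigenvalue is the Frobenius inner product of A with g g', a matrix of norm 1, so
    Cauchy-Schwarz bounds it by the Frobenius norm of A, hence by the trace. *)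
Lemma posdef_eigen_le_tr (R : realType) (m : nat) (A : 'M[R]_m) (g : 'cV[R]_m) (l : R) :
  posdef A -> A *m g = l *: g -> (g^T *m g) 0 0 = 1 -> 0 <= \tr A -> l <= \tr A.
Proof.
move=> Apd Ag g1 tr0.
have lE : l = \sum_i \sum_j A i j * (g *m g^T) i j.
  rewrite -[l]mulr1 -g1 -(quad_eigen Ag) quadE.
  by apply: eq_bigr => i _; apply: eq_bigr => j _; rewrite !mxE big_ord1 !mxE.
have l2 : l ^+ 2 <= \tr A ^+ 2.
  rewrite {1}lE; apply: le_trans (cauchy_schwarz_mx _ _) _.
  by rewrite sqnorm_outer g1 !mulr1; exact: posdef_sqnorm_le.
have [l0|l0] := ltP l 0; first exact: ltW (lt_le_trans l0 tr0).
by rewrite -(@ler_pXn2r _ 2).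
Qed.

(** Subtracting (lam 0 - lam 1) g g' lowers the leading eigenvalue to lam 1, which is then the
    largest one; the Rayleigh bound for the deflated matrix is the claim. *)
Lemma quad_gap (R : realType) (m : nat) (A : 'M[R]_m) (lam : nat -> R)
    (g x : 'cV[R]_m) :
  (2 <= m)%N -> A^T = A -> eigenvalues_of A lam ->
  (forall i, (1 <= i)%N -> (i < m)%N -> lam i <= lam 1) ->
  A *m g = lam 0%N *: g -> (g^T *m g) 0 0 = 1 ->
  quad A x <= lam 1 * (x^T *m x) 0 0 + (lam 0 - lam 1) * (x^T *m g) 0 0 ^+ 2.
Proof.
move=> m2 As Alam lam1 Ag g1.
have := char_poly_deflate (lam 0 - lam 1) Ag g1.
rewrite subKr Alam; case: m m2 => // m m2 in A g x As Alam lam1 Ag g1 *.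
rewrite big_ord_recl /= [LHS]mulrC -mulrA.
have X0 : 'X - (lam 0)%:P != 0 by rewrite polyXsubC_eq0.
move=> /(mulfI X0) chi.
have := @rayleigh R _ (A - (lam 0 - lam 1) *: (g *m g^T)) (lam 1) x.
rewrite quadDl -scaleNr quadZl quad_outer mulNr lerBlDr; apply.
  by rewrite linearD/= linearZ/= As trmx_mul trmxK.
move=> l'; rewrite eigenvalue_root_char scaleNr chi rootM => /orP[|].
  rewrite /root horner_prod => /prodf_eq0[i _].
  by rewrite hornerXsubC subr_eq0 => /eqP ->; apply: lam1; rewrite /bump leq0n ?ltnS.
by rewrite root_XsubC => /eqP ->.
Qed.

(** With x = v'g, the sign that agrees with x gives squared distance 2 - 2 |x|, and x^2 <= |x|
    because |x| <= 1. *)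
Lemma min_sign_dist (R : realType) (m : nat) (v g : 'cV[R]_m) :
  enorm v = 1 -> enorm g = 1 ->
  Num.min (enorm (1 *: v - g)) (enorm (- 1 *: v - g)) ^+ 2 <=
  2 * (1 - (v^T *m g) 0 0 ^+ 2).
Proof.
move=> v1 g1; set x : R := (v^T *m g) 0 0.
have vv : (v^T *m v) 0 0 = 1 by rewrite -sqr_enorm v1 expr1n.
have gg : (g^T *m g) 0 0 = 1 by rewrite -sqr_enorm g1 expr1n.
have x1 : x ^+ 2 <= 1.
  by have := sqnorm_ge0 (v *m v^T - g *m g^T); rewrite sqnorm_sub_outer vv gg -/x; lra.
have E (t : R) : t ^+ 2 = 1 -> enorm (t *: v - g) ^+ 2 = 2 - 2 * t * x.
  move=> t1; rewrite sqr_enorm.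
  have -> : (t *: v - g)^T = t *: v^T - g^T by rewrite linearB linearZ.
  rewrite mulmxBl !mulmxBr -!scalemxAl -!scalemxAr scalerA -expr2 t1 scale1r.
  have BE (M N : 'M[R]_1) : (M - N) 0 0 = M 0 0 - N 0 0 by rewrite !mxE.
  have ZE (c : R) (N : 'M[R]_1) : (c *: N) 0 0 = c * N 0 0 by rewrite mxE.
  rewrite !BE !ZE vv gg -(dotC v g) -/x; ring.
set a : R := enorm (1 *: v - g); set b : R := enorm (- 1 *: v - g).
have a0 : 0 <= a by exact: enorm_ge0.
have b0 : 0 <= b by exact: enorm_ge0.
have min0 : 0 <= Num.min a b by rewrite le_min a0.
have [x0|x0] := leP 0 x.
  apply: (@le_trans _ _ (a ^+ 2)).
    by rewrite ler_pXn2r// ge_min lexx.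
  rewrite E ?expr1n//; suff : x ^+ 2 <= x by lra.
  have : x <= 1 by rewrite -(@expr_le1 _ 2).
  by move=> ?; rewrite expr2 ler_piMl.
apply: (@le_trans _ _ (b ^+ 2)).
  by rewrite ler_pXn2r// ge_min lexx orbT.
rewrite E ?sqrrN ?expr1n//; suff : x ^+ 2 <= - x by lra.
have : - x <= 1 by rewrite -(@expr_le1 _ 2) ?sqrrN// oppr_ge0 ltW.
by move=> ?; rewrite -sqrrN expr2 ler_piMl// oppr_ge0 ltW.
Qed.

(* Comparing the Rayleigh quotients of [S] at [v] and [g] turns the spectral gap
   [h + k * (l1 - l2)] of the population matrix into a bound on the sine of the
   angle between [v] and [g] (Davis-Kahan). *)
Lemma davis_kahan (R : realType) (m : nat) (S A : 'M[R]_m) (v g : 'cV[R]_m)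
    (h k l1 l2 : R) :
  S^T = S -> principal_eigenvector S v -> enorm g = 1 -> A *m g = l1 *: g ->
  0 <= k ->
  (forall x, quad A x <= l2 * (x^T *m x) 0 0 + (l1 - l2) * (x^T *m g) 0 0 ^+ 2) ->
  0 < h + k * (l1 - l2) ->
  Num.min (enorm (1 *: v - g)) (enorm (- 1 *: v - g)) ^+ 2 *
    (h + k * (l1 - l2)) ^+ 2 <=
  4 * sqnorm (S - (h *: (g *m g^T) + k *: A)).
Proof.
move=> Ss [v1 [l [Sv lmax]]] g1 Ag k0 gap; set G := h + _ => G0.
set T := h *: _ + _; set D := S - T.
set x : R := (v^T *m g) 0 0.
have vv : (v^T *m v) 0 0 = 1 by rewrite -sqr_enorm v1 expr1n.
have gg : (g^T *m g) 0 0 = 1 by rewrite -sqr_enorm g1 expr1n.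
have x1 : 0 <= 1 - x ^+ 2.
  by have := sqnorm_ge0 (v *m v^T - g *m g^T); rewrite sqnorm_sub_outer vv gg -/x; lra.
have SgSv : quad S g <= quad S v.
  by rewrite (quad_eigen Sv) vv -gg; exact: rayleigh.
have SE u : quad S u = quad T u + quad D u by rewrite -quadDl addrC subrK.
have TE u : quad T u = h * (u^T *m g) 0 0 ^+ 2 + k * quad A u.
  by rewrite quadDl !quadZl quad_outer.
have Tg : quad T g = h + k * l1.
  by rewrite TE (quad_eigen Ag) gg expr1n !mulr1.
have Tv : quad T v <= h * x ^+ 2 + k * (l2 + (l1 - l2) * x ^+ 2).
  by rewrite TE lerD2l ler_wpM2l//; have := gap v; rewrite vv mulr1.
(* [W] is bounded below by G times the squared sine of the angle ([GW]) and above, by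
   Cauchy-Schwarz, by a multiple of the sine itself ([W2]); in [main] one factor of the squared sine
   cancels. *)
pose W := \sum_i \sum_j D i j * (v *m v^T - g *m g^T) i j.
have WE : W = quad D v - quad D g.
  rewrite !quadE -sumrB; apply: eq_bigr => i _; rewrite -sumrB.
  by apply: eq_bigr => j _; rewrite !mxE !big_ord1 !mxE; ring.
have GW : G * (1 - x ^+ 2) <= W.
  by rewrite WE /G; move: SgSv; rewrite !SE Tg; move: Tv; nra.
have W2 : W ^+ 2 <= sqnorm D * (2 * (1 - x ^+ 2)).
  apply: le_trans (cauchy_schwarz_mx _ _) _.
  by rewrite sqnorm_sub_outer vv gg -/x; apply: ler_wpM2l; [exact: sqnorm_ge0|lra].
have G1 : (G * (1 - x ^+ 2)) ^+ 2 <= sqnorm D * (2 * (1 - x ^+ 2)).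
  apply: le_trans W2; rewrite ler_pXn2r ?nnegrE//.
    by rewrite mulr_ge0// ltW.
  by apply: le_trans GW; rewrite mulr_ge0// ltW.
have main : (1 - x ^+ 2) * G ^+ 2 <= 2 * sqnorm D.
  have [->|x2] := eqVneq (1 - x ^+ 2) 0.
    by rewrite mul0r mulr_ge0// sqnorm_ge0.
  have x3 : 0 < 1 - x ^+ 2 by rewrite lt_neqAle eq_sym x2.
  by rewrite -(ler_pM2r x3); move: G1; nra.
have dist := min_sign_dist v1 g1.
apply: (@le_trans _ _ (2 * (1 - x ^+ 2) * G ^+ 2)).
  by rewrite ler_wpM2r// exprn_ge0// ltW.
by rewrite -mulrA; lra.
Qed.

(** * Second moments of the noise *)

Lemma sum_mul_delta (R : realType) (n : nat) (f : 'I_n -> R) (i : 'I_n) :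
  \sum_l f l * (i == l)%:R = f i.
Proof.
rewrite (bigD1 i)//= eqxx mulr1 big1 ?addr0// => l li.
by rewrite eq_sym (negbTE li) mulr0.
Qed.

(** Input for polarisation, where a, b, c will be signs. The first coefficient is fixed to 1 because
    even powers ignore a global sign. The indices may coincide. *)
Lemma mvnormal_moment4_comb (R : realType) (d : measure_display)
    (T : measurableType d) (P : probability T R) (m : nat)
    (Z : T -> 'cV[R]_m) (V : 'M[R]_m) (i j k l : 'I_m) (a b c : R) :
  V^T = V -> (forall t, 0 <= quad V t) -> mvnormal P Z 0 V ->
  let L w := Z w i 0 + a * Z w j 0 + b * Z w k 0 + c * Z w l 0 in
  let s2 := V i i + a ^+ 2 * V j j + b ^+ 2 * V k k + c ^+ 2 * V l l +
    2 * (a * V i j + b * V i k + c * V i l + a * b * V j k + a * c * V j l +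
         b * c * V k l) in
  has_mean P (fun w => L w ^+ 2) s2 /\ has_mean P (fun w => L w ^+ 4) (3 * s2 ^+ 2).
Proof.
move=> Vs V0 ZV L s2.
have Vsym x y : V y x = V x y by rewrite -[in LHS]Vs mxE.
pose t : 'cV[R]_m := delta_mx i 0 + a *: delta_mx j 0 + b *: delta_mx k 0 +
  c *: delta_mx l 0.
have tT : t^T = delta_mx 0 i + a *: delta_mx 0 j + b *: delta_mx 0 k +
    c *: delta_mx 0 l.
  by rewrite /t !linearD !linearZ/= !trmx_delta.
have SE (M N : 'M[R]_1) : (M + N) 0 0 = M 0 0 + N 0 0 by rewrite mxE.
have ZE (x : R) (N : 'M[R]_1) : (x *: N) 0 0 = x * N 0 0 by rewrite mxE.
have tE w : (t^T *m Z w) 0 0 = L w.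
  by rewrite tT !mulmxDl -!scalemxAl !SE !ZE -!rowE !mxE.
have QE : quad V t = s2.
  have DE x y : ((delta_mx 0 x : 'rV[R]_m) *m V *m (delta_mx y 0 : 'cV[R]_m)) 0 0 = V x y.
    by rewrite -rowE -colE !mxE.
  rewrite /quad tT /t !mulmxDl !mulmxDr -!scalemxAl -!scalemxAr.
  rewrite !SE !ZE !DE /s2.
  rewrite (Vsym i j) (Vsym i k) (Vsym i l) (Vsym j k) (Vsym j l) (Vsym k l).
  ring.
have lawL : has_law P L (gaussian 0 s2).
  have := ZV t; rewrite mulmx0 mxE -/(quad V t) QE.
  by rewrite (_ : (fun w => _) = L)//; apply/funext => w; rewrite tE.
by apply: gaussian_moments => //; rewrite -QE.
Qed.

Lemma mvnormal_mean2 (R : realType) (d : measure_display)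
    (T : measurableType d) (P : probability T R) (m : nat)
    (Z : T -> 'cV[R]_m) (V : 'M[R]_m) (i j : 'I_m) :
  V^T = V -> (forall t, 0 <= quad V t) -> mvnormal P Z 0 V ->
  has_mean P (fun w => Z w i 0 * Z w j 0) (V i j).
Proof.
move=> Vs V0 ZV.
(* Two coefficients are set to zero, leaving 4 x y = (x + y)^2 - (x - y)^2. *)
have M a := (mvnormal_moment4_comb i j i i a 0 0 Vs V0 ZV).1.
apply: has_mean_eq (has_meanD (has_meanZ 4^-1 (M 1)) (has_meanZ (- 4^-1) (M (- 1)))).
  by move=> w /=; field.
by field.
Qed.

(* Isserlis' formula, obtained by polarising the fourth moments of the linear forms. *)
Lemma mvnormal_mean4 (R : realType) (d : measure_display)
    (T : measurableType d) (P : probability T R) (m : nat)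
    (Z : T -> 'cV[R]_m) (V : 'M[R]_m) (i j k l : 'I_m) :
  V^T = V -> (forall t, 0 <= quad V t) -> mvnormal P Z 0 V ->
  has_mean P (fun w => Z w i 0 * Z w j 0 * (Z w k 0 * Z w l 0))
    (V i j * V k l + V i k * V j l + V i l * V j k).
Proof.
move=> Vs V0 ZV.
have M a b c := (mvnormal_moment4_comb i j k l a b c Vs V0 ZV).2.
(* Weighting by the sign a b c keeps only the monomial that is odd in each sign. It has coefficient
   4! in each of the 8 fourth powers, and 8 * 24 = 192. *)
pose N a b c := has_meanZ (a * b * c / 192) (M a b c).
apply: has_mean_eq (has_meanD
  (has_meanD (has_meanD (N 1 1 1) (N 1 1 (-1))) (has_meanD (N 1 (-1) 1) (N 1 (-1) (-1))))
  (has_meanD (has_meanD (N (-1) 1 1) (N (-1) 1 (-1)))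
     (has_meanD (N (-1) (-1) 1) (N (-1) (-1) (-1))))).
  by move=> w /=; field.
by field.
Qed.

(** The identity factor decouples the observations: the form is a sum over i < n of the form of A on
    the slice of t belonging to row i of the noise. *)
Lemma tens1_quad_ge0 (R : realType) (n p : nat) (A : 'M[R]_p) (t : 'cV[R]_(p * n)) :
  posdef A -> 0 <= quad (A *t (1%:M : 'M[R]_n)) t.
Proof.
move=> Apd.
have -> : quad (A *t (1%:M : 'M[R]_n)) t =
    \sum_(i < n) quad A (\col_j t (mxtens_index (j, i)) 0).
  have bij : {on [pred _ | true], bijective (@mxtens_index p n)}.
    by apply: onW_bij; exists (@mxtens_unindex p n);
      [exact: mxtens_indexK|exact: mxtens_unindexK].
  rewrite quadE (reindex _ bij)/=.
  under eq_bigr => k _ do rewrite (reindex _ bij)/=.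
  rewrite [LHS](_ : _ = \sum_(j < p) \sum_(i < n) \sum_(j' < p) \sum_(i' < n)
     (A j j' * (i == i')%:R * (t (mxtens_index (j, i)) 0 * t (mxtens_index (j', i')) 0))).
    rewrite exchange_big; apply: eq_bigr => i _; rewrite quadE.
    apply: eq_bigr => j _; apply: eq_bigr => j' _; rewrite !mxE.
    rewrite -[RHS](sum_mul_delta (fun i' => A j j' * (t (mxtens_index (j, i)) 0 *
       t (mxtens_index (j', i')) 0)) i).
    by apply: eq_bigr => i' _; ring.
  rewrite (pair_big predT predT (fun j i => \sum_j' \sum_i' _))/=.
  apply: eq_bigr => -[j i] _; rewrite pair_big/=.
  by apply: eq_bigr => -[j' i'] _; rewrite tensmxE mxE.
by rewrite sumr_ge0// => i _; exact: posdef_quad_ge0.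
Qed.

Definition noise_law (R : realType) (d : measure_display) (T : measurableType d)
    (P : probability T R) (n p : nat) (E : T -> 'M[R]_(n, p)) (A : 'M[R]_p) : Prop :=
  posdef A /\ mvnormal P (fun w => vec (E w)) 0 (A *t (1%:M : 'M[R]_n)).

Lemma vecE (R : realType) (n p : nat) (E : 'M[R]_(n, p)) i j :
  vec E (mxtens_index (j, i)) 0 = E i j.
Proof. by rewrite mxE mxtens_indexK. Qed.

Lemma noise_mean2 (R : realType) (d : measure_display) (T : measurableType d)
    (P : probability T R) (n p : nat) (E : T -> 'M[R]_(n, p)) (A : 'M[R]_p)
    (i k : 'I_n) (j l : 'I_p) :
  noise_law P E A ->
  has_mean P (fun w => E w i j * E w k l) (A j l * (i == k)%:R).
Proof.
move=> [Apd EN].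
have Vs : (A *t (1%:M : 'M[R]_n))^T = A *t 1%:M by rewrite trmx_tens trmx1 Apd.1.
have := mvnormal_mean2 (mxtens_index (j, i)) (mxtens_index (l, k)) Vs
  (fun t => tens1_quad_ge0 t Apd) EN.
by apply: has_mean_eq => [w|]; rewrite ?vecE// tensmxE mxE.
Qed.

Lemma noise_mean4 (R : realType) (d : measure_display) (T : measurableType d)
    (P : probability T R) (n p : nat) (E : T -> 'M[R]_(n, p)) (A : 'M[R]_p)
    (i1 i2 i3 i4 : 'I_n) (j1 j2 j3 j4 : 'I_p) :
  noise_law P E A ->
  has_mean P (fun w => E w i1 j1 * E w i2 j2 * (E w i3 j3 * E w i4 j4))
    (A j1 j2 * (i1 == i2)%:R * (A j3 j4 * (i3 == i4)%:R) +
     A j1 j3 * (i1 == i3)%:R * (A j2 j4 * (i2 == i4)%:R) +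
     A j1 j4 * (i1 == i4)%:R * (A j2 j3 * (i2 == i3)%:R)).
Proof.
move=> [Apd EN].
have Vs : (A *t (1%:M : 'M[R]_n))^T = A *t 1%:M by rewrite trmx_tens trmx1 Apd.1.
have := mvnormal_mean4 (mxtens_index (j1, i1)) (mxtens_index (j2, i2))
  (mxtens_index (j3, i3)) (mxtens_index (j4, i4)) Vs
  (fun t => tens1_quad_ge0 t Apd) EN.
by apply: has_mean_eq => [w|]; rewrite ?vecE// !tensmxE !mxE.
Qed.

Lemma noise_mean_linear (R : realType) (d : measure_display) (T : measurableType d)
    (P : probability T R) (n p : nat) (E : T -> 'M[R]_(n, p)) (A : 'M[R]_p)
    (u : 'cV[R]_n) :
  noise_law P E A ->
  has_mean P (fun w => sqnorm ((E w)^T *m u)) ((u^T *m u) 0 0 * \tr A).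
Proof.
move=> EA.
have := has_mean_sum (index_enum 'I_p) (fun j => has_mean_sum (index_enum 'I_n)
  (fun i => has_mean_sum (index_enum 'I_n)
  (fun k => has_meanZ (u i 0 * u k 0) (noise_mean2 i k j j EA)))).
apply: has_mean_eq => [w|].
  apply: eq_bigr => j _; rewrite big_ord1 mxE expr2 big_distrlr.
  by apply: eq_bigr => i _; apply: eq_bigr => k _; rewrite !mxE /=; ring.
rewrite mulr_sumr; apply: eq_bigr => j _; rewrite mxE mulr_suml.
apply: eq_bigr => i _; rewrite !mxE.
rewrite -[RHS](sum_mul_delta (fun k => u i 0 * u k 0 * A j j) i).
by apply: eq_bigr => k _; ring.
Qed.

(** In Isserlis' formula for the square of entry (j, l), the first pairing gives the squared mean
    and cancels on centring. The other two give |B|^2 A_jj A_ll and |B|^2 A_jl^2, which sum to |B|^2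
    ((tr A)^2 + |A|^2): the quantity [a] of the optimal weight. *)
Lemma noise_mean_quadratic (R : realType) (d : measure_display) (T : measurableType d)
    (P : probability T R) (n p : nat) (E : T -> 'M[R]_(n, p)) (A : 'M[R]_p)
    (B : 'M[R]_n) :
  B^T = B -> noise_law P E A ->
  has_mean P (fun w => sqnorm ((E w)^T *m B *m E w - \tr B *: A))
    (sqnorm B * (sqnorm A + \tr A ^+ 2)).
Proof.
move=> Bs EA.
have Bsym i k : B k i = B i k by rewrite -[in LHS]Bs mxE.
pose I := index_enum 'I_n.
pose X j l w := \sum_(i <- I) \sum_(k <- I) B i k * (E w i j * E w k l).
have X1 j l : has_mean P (X j l) (\tr B * A j l).
  have := has_mean_sum I (fun i => has_mean_sum I
    (fun k => has_meanZ (B i k) (noise_mean2 i k j l EA))).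
  apply: has_mean_eq => //; rewrite mulr_suml; apply: eq_bigr => i _.
  rewrite -[RHS](sum_mul_delta (fun k => B i k * A j l) i).
  by apply: eq_bigr => k _; ring.
have X2 j l : has_mean P (fun w => X j l w ^+ 2)
    ((\tr B * A j l) ^+ 2 + sqnorm B * (A j j * A l l) + sqnorm B * A j l ^+ 2).
  have := has_mean_sum I (fun i => has_mean_sum I (fun k =>
    has_mean_sum I (fun i' => has_mean_sum I (fun k' =>
    has_meanZ (B i k * B i' k') (noise_mean4 i k i' k' j l j l EA))))).
  apply: has_mean_eq => [w|].
    rewrite /X expr2 big_distrl; apply: eq_bigr => i _.
    rewrite big_distrl; apply: eq_bigr => k _ /=.
    rewrite big_distrr; apply: eq_bigr => i' _ /=.
    rewrite big_distrr; apply: eq_bigr => k' _ /=; ring.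
  have Alj : A l j = A j l by rewrite -[in LHS]EA.1.1 mxE.
  have inner i k : \sum_(i' <- I) \sum_(k' <- I) B i k * B i' k' *
       (A j l * (i == k)%:R * (A j l * (i' == k')%:R) +
        A j j * (i == i')%:R * (A l l * (k == k')%:R) +
        A j l * (i == k')%:R * (A l j * (k == i')%:R)) =
      \tr B * A j l ^+ 2 * B i k * (i == k)%:R +
      B i k ^+ 2 * (A j j * A l l + A j l ^+ 2).
    (* [x1], [x2], [x3] are what the three pairings leave once the sum over k' has been collapsed by
       a Kronecker delta. *)
    pose x1 i' := B i k * B i' i' * A j l ^+ 2 * (i == k)%:R.
    pose x2 i' := B i k * B i' k * (A j j * A l l).
    pose x3 i' := B i k * B i' i * A j l ^+ 2.
    transitivity (\sum_(i' <- I) (x1 i' + x2 i' * (i == i')%:R + x3 i' * (k == i')%:R)).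
      apply: eq_bigr => i' _.
      rewrite -[x1 i'](sum_mul_delta (fun k' => B i k * B i' k' * A j l ^+ 2 * (i == k)%:R)).
      rewrite -[x2 i'](sum_mul_delta (fun k' => B i k * B i' k' * (A j j * A l l))).
      rewrite -[x3 i'](sum_mul_delta (fun k' => B i k * B i' k' * A j l ^+ 2)).
      rewrite !mulr_suml -!big_split; apply: eq_bigr => k' _ /=.
      rewrite Alj; ring.
    rewrite !big_split/= !sum_mul_delta /x1 /x2 /x3 (Bsym i k).
    rewrite -!mulr_suml -mulr_sumr -/(\tr B); ring.
  under eq_bigr => i _ do under eq_bigr => k _ do rewrite inner.
  under eq_bigr => i _ do rewrite big_split/= sum_mul_delta -mulr_suml.
  rewrite big_split/= -mulr_sumr -mulr_suml -/(sqnorm B) -/(\tr B); ring.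
(* Each centred square is expanded as X^2 - 2 m X + m^2 with m = tr B * A_jl. *)
have := has_mean_sum (index_enum 'I_p) (fun j => has_mean_sum (index_enum 'I_p) (fun l =>
  has_meanD (has_meanD (X2 j l) (has_meanZ (- 2 * (\tr B * A j l)) (X1 j l)))
    (has_mean_cst P ((\tr B * A j l) ^+ 2)))).
apply: has_mean_eq => [w|].
  apply: eq_bigr => j _; apply: eq_bigr => l _.
  have -> : ((E w)^T *m B *m E w - \tr B *: A) j l = X j l w - \tr B * A j l.
    rewrite mxE [(_ *m E w) j l]mxE !mxE; congr (_ - _).
    rewrite /X exchange_big; apply: eq_bigr => k _ /=.
    rewrite mxE mulr_suml; apply: eq_bigr => i _; rewrite mxE; ring.
  ring.
transitivity (\sum_j \sum_l (sqnorm B * (A j j * A l l) + sqnorm B * A j l ^+ 2)).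
  by apply: eq_bigr => j _; apply: eq_bigr => l _; ring.
have trE : \tr A ^+ 2 = \sum_j \sum_l A j j * A l l by rewrite expr2 big_distrlr.
have sqE : sqnorm A = \sum_j \sum_l A j l ^+ 2 by [].
rewrite trE sqE -big_split mulr_sumr; apply: eq_bigr => j _ /=.
rewrite -big_split mulr_sumr; apply: eq_bigr => l _ /=; ring.
Qed.

(** The inequality |M + N|^2 <= 2 |M|^2 + 2 |N|^2 is used twice. The two cross terms are rank one
    with norm |E'u| each, since [g] is a unit vector, whence 8 = 2 * (2 + 2). *)
Lemma sqnorm_noise_le (R : realType) (n p : nat) (E : 'M[R]_(n, p)) (B : 'M[R]_n)
    (A : 'M[R]_p) (u : 'cV[R]_n) (g : 'cV[R]_p) (b t : R) :
  (g^T *m g) 0 0 = 1 ->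
  sqnorm (b *: (E^T *m u *m g^T + g *m (u^T *m E)) + (E^T *m B *m E - t *: A)) <=
  8 * b ^+ 2 * sqnorm (E^T *m u) + 2 * sqnorm (E^T *m B *m E - t *: A).
Proof.
move=> g1.
have le2 (M N : 'M[R]_p) : sqnorm (M + N) <= 2 * sqnorm M + 2 * sqnorm N.
  rewrite /sqnorm !mulr_sumr -big_split; apply: ler_sum => i _ /=.
  rewrite !mulr_sumr -big_split; apply: ler_sum => j _ /=.
  rewrite !mxE -subr_ge0.
  have -> : 2 * M i j ^+ 2 + 2 * N i j ^+ 2 - (M i j + N i j) ^+ 2 =
     (M i j - N i j) ^+ 2 by ring.
  exact: sqr_ge0.
have sqZ (c : R) (M : 'M[R]_p) : sqnorm (c *: M) = c ^+ 2 * sqnorm M.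
  rewrite /sqnorm mulr_sumr; apply: eq_bigr => i _.
  by rewrite mulr_sumr; apply: eq_bigr => j _; rewrite mxE exprMn.
have sqE : (((E^T *m u)^T *m (E^T *m u)) 0 0) = sqnorm (E^T *m u).
  rewrite mxE; apply: eq_bigr => i _; rewrite big_ord1 [in LHS]mxE; ring.
apply: le_trans (le2 _ _) _; rewrite lerD2r sqZ.
have -> : u^T *m E = (E^T *m u)^T by rewrite trmx_mul trmxK.
have := le2 (E^T *m u *m g^T) (g *m (E^T *m u)^T).
rewrite !sqnorm_outer g1 mulr1 mul1r sqE => H.
have b0 : 0 <= b ^+ 2 by exact: sqr_ge0.
nra.
Qed.

(** * The estimator *)

Section Model.
Variables (R : realType) (q : nat) (M : allometric_model R q).
Notation n := (nobs M).
Notation p := (dimy M).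
Notation X := (design M).
Notation ones := (const_mx 1 : 'cV[R]_n).
Notation P := (proj_design M).

Lemma gram_unit : X^T *m X \in unitmx.
Proof.
rewrite -row_free_unit -kermx_eq0; apply/rowV0P => v /sub_kermxP vX.
have Xv : X *m v^T = 0.
  apply: dot_eq0; rewrite trmx_mul trmxK -mulmxA (mulmxA X^T).
  by rewrite mulmxA vX mul0mx mxE.
have fX : row_free X^T by rewrite /row_free mxrank_tr rank_design.
apply/eqP; rewrite -(mulmx_free_eq0 _ fX).
by rewrite -[v]trmxK -trmx_mul Xv trmx0.
Qed.

Lemma proj_tr : P^T = P.
Proof.
by rewrite /proj_design !trmx_mul trmxK trmx_inv trmx_mul trmxK mulmxA.
Qed.

Lemma proj_design_X : P *m X = X.
Proof. by rewrite /proj_design -mulmxA mulmxKV// gram_unit. Qed.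

Lemma proj_idem : P *m P = P.
Proof. by rewrite {2}/proj_design !mulmxA proj_design_X. Qed.

Lemma proj_ones : P *m ones = 0.
Proof. by rewrite /proj_design -mulmxA design_centered mulmx0. Qed.

Lemma tr_proj : \tr P = q%:R.
Proof. by rewrite /proj_design mxtrace_mulC mulmxA mulmxV ?gram_unit// mxtrace1. Qed.

(** The orthogonal projection onto the complement of the span of the all-ones vector and the columns
    of X. *)
Definition resid : 'M[R]_n := 1%:M - n%:R^-1 *: (ones *m ones^T) - P.

Lemma nobs_neq0 : n%:R != 0 :> R.
Proof. by rewrite pnatr_eq0 -lt0n; exact: leq_trans (nobs_gt M). Qed.

Lemma ones_dot : ones^T *m ones = n%:R%:M.
Proof.
apply/matrixP => i j; rewrite !ord1 !mxE eqxx mulr1n.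
under eq_bigr do rewrite !mxE mulr1.
by rewrite sumr_const card_ord.
Qed.

Lemma resid_tr : resid^T = resid.
Proof.
by rewrite /resid !linearB/= linearZ/= trmx_mul trmxK trmx1 proj_tr.
Qed.

Lemma resid_ones : resid *m ones = 0.
Proof.
rewrite /resid !mulmxBl mul1mx -scalemxAl -mulmxA ones_dot proj_ones subr0.
by rewrite mul_mx_scalar scalerA mulVf ?nobs_neq0// scale1r subrr.
Qed.

Lemma resid_X : resid *m X = 0.
Proof.
rewrite /resid !mulmxBl mul1mx -scalemxAl -mulmxA proj_design_X.
have -> : ones^T *m X = 0 by rewrite -[LHS]trmxK trmx_mul trmxK design_centered trmx0.
by rewrite mulmx0 scaler0 subr0 subrr.
Qed.

Lemma resid_proj : resid *m P = 0.
Proof. by rewrite /proj_design !mulmxA resid_X !mul0mx. Qed.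

Lemma proj_resid : P *m resid = 0.
Proof. by rewrite -[LHS]trmxK trmx_mul resid_tr proj_tr resid_proj trmx0. Qed.

Lemma resid_idem : resid *m resid = resid.
Proof.
rewrite {2}/resid !mulmxBr mulmx1 -scalemxAr mulmxA resid_ones resid_proj.
by rewrite mul0mx scaler0 !subr0.
Qed.

Lemma tr_resid : \tr resid = (n - q.+1)%:R.
Proof.
rewrite /resid !linearB/= linearZ/= mxtrace1 tr_proj mxtrace_mulC ones_dot.
rewrite mxtrace_scalar mulr1n mulVf ?nobs_neq0// natrB; last exact: ltnW (nobs_gt M).
by rewrite -natr1; ring.
Qed.

(** The middle matrix of S(w) as a quadratic expression in Y. It combines two mutually annihilating
    projections, which makes its trace and Frobenius norm explicit. *)
Definition mix (wt : R) : 'M[R]_n := (1 - wt) *: P + wt *: resid.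

Lemma mix_tr wt : (mix wt)^T = mix wt.
Proof. by rewrite /mix linearD !linearZ/= proj_tr resid_tr. Qed.

Lemma tr_mix wt : \tr (mix wt) = (1 - wt) * q%:R + wt * (n - q.+1)%:R.
Proof. by rewrite /mix linearD !linearZ/= tr_proj tr_resid. Qed.

Lemma sqnorm_mix wt :
  sqnorm (mix wt) = (1 - wt) ^+ 2 * q%:R + wt ^+ 2 * (n - q.+1)%:R.
Proof.
rewrite -sym_tr_sqr ?mix_tr// /mix mulmxDl !mulmxDr -!scalemxAl -!scalemxAr.
rewrite proj_idem resid_idem proj_resid resid_proj !scaler0 addr0 add0r.
by rewrite linearD !linearZ/= tr_proj tr_resid !mulrA !expr2.
Qed.

Let u : 'cV[R]_n := X *m coeff M.
Notation g := (gamma1 M).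

Lemma gamma1_dot : (g^T *m g) 0 0 = 1.
Proof. by rewrite -sqr_enorm gamma1_unit expr1n. Qed.

Lemma S_mixE wt (w : sample M) : S_mix wt w = (obs w)^T *m mix wt *m obs w.
Proof.
rewrite /S_mix /S_R /S_E -/resid /mix; move: resid (obs w) => Q Y.
by rewrite mulmxDr mulmxDl -!scalemxAr -!scalemxAl.
Qed.

Lemma S_mix_tr wt (w : sample M) : (S_mix wt w)^T = S_mix wt w.
Proof. by rewrite S_mixE !trmx_mul trmxK mix_tr mulmxA. Qed.

(** [mix] annihilates the all-ones vector, which removes the mean, and multiplies the columns of X
    by 1 - w, since P fixes them and [resid] kills them. *)
Lemma S_mix_decomp wt (w : sample M) :
  S_mix wt w = ((1 - wt) * signal M) *: (g *m g^T) +
    (1 - wt) *: ((noise w)^T *m u *m g^T + g *m (u^T *m noise w)) +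
    (noise w)^T *m mix wt *m noise w.
Proof.
set E := noise w; set Y := obs w.
have mixu : mix wt *m u = (1 - wt) *: u.
  rewrite /mix mulmxDl -!scalemxAl /u !mulmxA proj_design_X resid_X mul0mx.
  by rewrite scaler0 addr0.
have mixY : mix wt *m Y = (1 - wt) *: (u *m g^T) + mix wt *m E.
  rewrite /Y/obs !mulmxDr !mulmxA mulmxDl -!scalemxAl proj_ones resid_ones.
  rewrite !scaler0 addr0 !mul0mx add0r; congr (_ + _).
  by rewrite -(mulmxA _ X) -/u mixu -scalemxAl.
have Yu : Y^T *m u = signal M *: g + E^T *m u.
  rewrite /Y/obs !linearD/= !mulmxDl !trmx_mul !trmxK -!mulmxA.
  rewrite /u (mulmxA ones^T).
  have -> : ones^T *m X = 0 by rewrite -[LHS]trmxK trmx_mul trmxK design_centered trmx0.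
  rewrite mul0mx mulmx0 add0r; congr (_ + _).
  have -> : (coeff M)^T *m (X^T *m (X *m coeff M)) = (signal M)%:M.
    by rewrite mulmxA -trmx_mul [LHS]mx11_scalar -sqr_enorm.
  by rewrite mul_mx_scalar.
rewrite S_mixE -/Y -mulmxA mixY mulmxDr -scalemxAr (mulmxA Y^T u) Yu.
have YB : Y^T *m mix wt = (1 - wt) *: (g *m u^T) + E^T *m mix wt.
  rewrite -{1}(mix_tr wt) -trmx_mul mixY linearD linearZ/=.
  by rewrite (trmx_mul u) trmxK (trmx_mul (mix wt)) mix_tr.
rewrite (mulmxA Y^T (mix wt)) YB !mulmxDl -!scalemxAl -(mulmxA g).
by rewrite [in LHS]scalerDr [in RHS]scalerDr scalerA !addrA.
Qed.

End Model.

Lemma measurable_sign_dist (R : realType) (q : nat) (M : allometric_model R q)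
    (v : sample M -> 'cV[R]_(dimy M)) :
  random_vector v -> measurable_fun [set: sample M] (fun w => sign_dist (v w)).
Proof.
move=> mv.
have mE (t : R) : measurable_fun [set: sample M] (fun w => enorm (t *: v w - gamma1 M)).
  rewrite /enorm; apply: (measurableT_comp (f := @Num.sqrt R)).
    by apply: continuous_measurable_fun; exact: sqrt_continuous.
  apply: measurable_sum => i; apply: measurable_funX.
  under eq_fun do rewrite !mxE.
  apply: measurable_funB => //; apply: measurable_funM => //; exact: mv.
exact: measurable_minr.
Qed.

(** Davis-Kahan against the population matrix (1 - w) c g g' + tr(mix) Sigma, then Markov's
    inequality for the squared distance. The constants 8 and 2 come from [sqnorm_noise_le], the 4
    from [davis_kahan]. *)
Lemma sign_dist_tail (R : realType) (q : nat) (M : allometric_model R q) (wt eps : R)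
    (v : sample M -> 'cV[R]_(dimy M)) :
  let c := signal M in
  let t := \tr (Sigma M) in
  let G := (1 - wt) * c + \tr (mix M wt) * eigengap M in
  let V := 8 * (1 - wt) ^+ 2 * c * t +
    2 * sqnorm (mix M wt) * (sqnorm (Sigma M) + t ^+ 2) in
  random_vector v ->
  (forall w, principal_eigenvector (S_mix wt w) (v w)) ->
  0 < eps -> 0 <= \tr (mix M wt) -> 0 < G ->
  (prob M [set w | (eps < `|sign_dist (v w)|)%R] <= (4 * V / (eps ^+ 2 * G ^+ 2))%:E)%E.
Proof.
move=> c t G V mv vS eps0 trm0 G0.
have EA : noise_law (@prob _ _ M) (@noise _ _ M) (Sigma M).
  by split; [exact: Sigma_posdef|exact: noise_normal].
set u := design M *m coeff M.
have uE : (u^T *m u) 0 0 = c by rewrite -sqr_enorm.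
have gap x : quad (Sigma M) x <= eigval M 1 * (x^T *m x) 0 0 +
    (eigval M 0 - eigval M 1) * (x^T *m gamma1 M) 0 0 ^+ 2.
  apply: quad_gap.
  - exact: dimy_ge2.
  - exact: (Sigma_posdef M).1.
  - exact: Sigma_eigval.
  - by move=> i i1 im; exact: eigval_noninc.
  - exact: gamma1_eigen.
  - exact: gamma1_dot.
have mean := has_meanD (has_meanZ (8 * (1 - wt) ^+ 2) (noise_mean_linear u EA))
  (has_meanZ 2 (noise_mean_quadratic (mix_tr M wt) EA)).
set F := (X in has_mean _ X _) in mean.
have F0 w : 0 <= F w.
  rewrite /F addr_ge0//; apply: mulr_ge0; rewrite ?sqnorm_ge0//.
  by rewrite mulr_ge0// sqr_ge0.
have dist w : sign_dist (v w) ^+ 2 * G ^+ 2 <= 4 * F w.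
  have := davis_kahan (h := (1 - wt) * c) (S_mix_tr wt w) (vS w) (gamma1_unit M)
    (gamma1_eigen M) trm0 gap G0.
  move=> /le_trans; apply; rewrite ler_pM2l//.
  have := sqnorm_noise_le (noise w) (mix M wt) (Sigma M) u (1 - wt)
    (\tr (mix M wt)) (gamma1_dot M).
  congr (sqnorm _ <= _); rewrite S_mix_decomp -/c -/u.
  (* The signal term h is common to S(w) and the population matrix and cancels. *)
  have AC (U : zmodType) (h x y z : U) : x + (y - z) = h + x + y - (h + z).
    by rewrite opprD -(addrA h) addrACA subrr add0r addrA.
  exact: AC.
have : (prob M [set w | (eps < `|sign_dist (v w)|)%R] <=
    (((8 * (1 - wt) ^+ 2) * ((u^T *m u) 0 0 * t) +
     2 * (sqnorm (mix M wt) * (sqnorm (Sigma M) + t ^+ 2))) /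
     (eps ^+ 2 * G ^+ 2 / 4))%:E)%E.
  apply: markov_has_mean F0 _ mean _ _.
  - by rewrite divr_gt0// mulr_gt0// exprn_gt0.
  - have -> : [set w | (eps < `|sign_dist (v w)|)%R] =
        [set: sample M] `&` (fun w => `|sign_dist (v w)|) @^-1` `]eps, +oo[%classic.
      by apply/seteqP; split => w /=; rewrite in_itv/= andbT; [|case].
    have mN : measurable_fun [set: sample M] (fun w => `|sign_dist (v w)|).
      by apply: measurableT_comp => //; exact: measurable_sign_dist.
    by apply: mN => //; exact: measurable_itv.
  - move=> w /= epsw; rewrite ler_pdivrMr// mulrC [F w * 4]mulrC.
    apply: le_trans (dist w); rewrite mulrC ler_wpM2r ?sqr_ge0//.
    by rewrite -[leRHS]real_normK ?num_real// ler_pXn2r ?nnegrE// ltW.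
move=> /le_trans; apply; rewrite lee_fin uE /V.
rewrite le_eqVlt; apply/orP; left; apply/eqP; field.
by rewrite !gt_eqF.
Qed.

Lemma eigengap_gt0 (R : realType) (q : nat) (M : allometric_model R q) : 0 < eigengap M.
Proof. by rewrite subr_gt0 eigval1_gt. Qed.

Lemma eigval0_gt0 (R : realType) (q : nat) (M : allometric_model R q) : 0 < eigval M 0.
Proof. by apply: eigval_gt0; exact: leq_trans (dimy_ge2 M). Qed.

(* At the optimal weight the ratio of the noise level to the squared spectral gap
   is a(qa+2bc)/H with H = a(c+qd)^2 + m d^2(aq+2bc); dropping either summand of H
   gives the two conclusions. *)
Lemma optimal_weight_tail (R : realType) (q : nat) (M : allometric_model R q) (eps : R)
    (v : sample M -> 'cV[R]_(dimy M)) :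
  let c := signal M in
  let t := \tr (Sigma M) in
  let m : R := (nobs M - q.+1)%:R in
  (0 < q)%N -> random_vector v ->
  (forall w, principal_eigenvector (S_mix (optimal_weight M) w) (v w)) ->
  0 < eps -> 0 < c -> 0 < t ->
  let pr := prob M [set w | (eps < `|sign_dist (v w)|)%R] in
  (pr <= ((2 * q%:R * t ^+ 2 + 4 * t * c) / c ^+ 2 * (16 / eps ^+ 2))%:E)%E /\
  (pr <= (2 * t ^+ 2 / (m * eigengap M ^+ 2) * (16 / eps ^+ 2))%:E)%E.
Proof.
move=> c t m q0 mv vS eps0 c0 t0 pr.
set d := eigengap M; have d0 : 0 < d := eigengap_gt0 M.
have m0 : 0 < m by rewrite ltr0n subn_gt0; exact: nobs_gt.
have q0' : 0 < q%:R :> R by rewrite ltr0n.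
have Sp := Sigma_posdef M.
set f := sqnorm (Sigma M).
have f0 : 0 <= f by exact: sqnorm_ge0.
have ft : f <= t ^+ 2 by exact: posdef_sqnorm_le.
set l := eigval M 0; have l0 : 0 < l := eigval0_gt0 M.
have lt_ : l <= t.
  by apply: posdef_eigen_le_tr Sp (gamma1_eigen M) (gamma1_dot M) (ltW t0).
pose a := f + t ^+ 2; pose b := l + t.
have a0 : 0 < a by rewrite ltr_wpDl// exprn_gt0.
have b0 : 0 < b by rewrite addr_gt0.
have bc0 : 0 < 2 * b * c by rewrite mulr_gt0// mulr_gt0.
have aq0 : 0 < a * q%:R by rewrite mulr_gt0.
have d20 : 0 < d ^+ 2 by rewrite exprn_gt0.
have md0 : 0 < m * d ^+ 2 by rewrite mulr_gt0.
set wt := optimal_weight M in vS *.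
(* The numerators of 1 - w* and w* over the common denominator [D]. *)
pose W1 := a * (d * q%:R + c); pose W2 := d * (a * q%:R + 2 * b * c).
have W10 : 0 < W1 by rewrite mulr_gt0// addr_gt0// mulr_gt0.
have W20 : 0 < W2 by rewrite mulr_gt0// addr_gt0.
pose D := W1 + W2; have D0 : 0 < D by rewrite addr_gt0.
have wtE : wt = W2 / D.
  rewrite /wt /optimal_weight (sym_tr_sqr Sp.1) -/f -/t -/a -/l -/b -/c -/d.
  by congr (_ / _); rewrite /D /W1 /W2; ring.
have wt1E : 1 - wt = W1 / D by rewrite wtE /D; field; exact: lt0r_neq0.
have trE : \tr (mix M wt) = (W1 * q%:R + W2 * m) / D.
  by rewrite tr_mix wt1E wtE -/m; field; exact: lt0r_neq0.
pose B := q%:R * a + 2 * b * c.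
have B0 : 0 < B by rewrite addr_gt0// mulrC.
pose H := a * (c + q%:R * d) ^+ 2 + m * d ^+ 2 * B.
have cqd0 : 0 < c + q%:R * d by rewrite addr_gt0// mulr_gt0.
have H1 : 0 < a * (c + q%:R * d) ^+ 2 by rewrite mulr_gt0// exprn_gt0.
have H2 : 0 < m * d ^+ 2 * B by rewrite mulr_gt0.
have H0 : 0 < H by rewrite addr_gt0.
have GE : (1 - wt) * c + \tr (mix M wt) * d = H / D.
  rewrite wt1E trE /H /W1 /W2 /B; field; exact: lt0r_neq0.
have tail : (pr <= (a * B / H * (16 / eps ^+ 2))%:E)%E.
  have := sign_dist_tail mv vS eps0.
  rewrite -/pr -/c -/d GE -/t -/f -/a => tl; apply: le_trans (tl _ _) _.
  - by rewrite trE divr_ge0 ?ltW// addr_gt0// mulr_gt0.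
  - by rewrite divr_gt0.
  rewrite lee_fin sqnorm_mix -/m wt1E wtE.
  have -> : a * B / H * (16 / eps ^+ 2) =
      4 * (4 * (a * B * H) / D ^+ 2) / (eps ^+ 2 * (H / D) ^+ 2).
    by field; rewrite !gt_eqF.
  apply: ler_wpM2r; first by rewrite invr_ge0 mulr_ge0// sqr_ge0.
  apply: ler_wpM2l => //.
  (* Raising the trace to b and the constant 2 to 4 turns the noise level into an expression that
     collapses exactly to 4 a B H / D^2 at the optimal weight; one factor H then cancels against the
     squared gap. *)
  have -> : 4 * (a * B * H) / D ^+ 2 =
      8 * (W1 / D) ^+ 2 * c * b +
      4 * ((W1 / D) ^+ 2 * q%:R + (W2 / D) ^+ 2 * m) * a.
    by rewrite /H /W1 /W2 /B; field; exact: lt0r_neq0.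
  apply: lerD.
    by rewrite ler_wpM2l ?lerDr ?ltW// mulr_gt0// mulr_gt0// exprn_gt0// divr_gt0.
  apply: ler_wpM2r; first exact: ltW.
  apply: ler_wpM2r; last by rewrite ler_nat.
  apply: addr_ge0; apply: mulr_ge0; rewrite ?sqr_ge0//; exact: ltW.
have at2 : a <= 2 * t ^+ 2 by rewrite /a; lra.
have bt2 : b <= 2 * t by rewrite /b; lra.
have e0 : 0 < 16 / eps ^+ 2 by rewrite divr_gt0// exprn_gt0.
clearbody c.
have c20 : 0 < c ^+ 2 by rewrite exprn_gt0.
split; apply: le_trans tail _; rewrite lee_fin ler_pM2r//.
  rewrite ler_pdivrMr// mulrAC ler_pdivlMr//.
  apply: (@le_trans _ _ (B * (a * (c + q%:R * d) ^+ 2))).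
    rewrite [leRHS]mulrA [B * a]mulrC; apply: ler_wpM2l; first exact/ltW/mulr_gt0.
    by rewrite ler_pXn2r ?nnegrE ?(ltW c0) ?(ltW cqd0)// lerDl ltW// mulr_gt0.
  apply: ler_pM; [exact: ltW|exact: ltW| |].
    rewrite /B; apply: lerD.
      by rewrite -mulrA mulrCA ler_pM2l//.
    by rewrite ler_pM2r//; lra.
  by rewrite lerDl ltW.
rewrite ler_pdivrMr// mulrAC ler_pdivlMr//.
rewrite -mulrA [B * _]mulrC; apply: ler_pM; [exact: ltW| |exact: at2|].
  exact: ltW.
by rewrite lerDr ltW.
Qed.

(** * Asymptotics *)

Lemma Theta_pow_lower (R : realType) (x : nat -> R) (p : nat -> nat) (u : R) :
  (forall k, (0 < p k)%N) -> Theta_pow x p u ->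
  exists2 K : R, 0 < K & \forall k \near \oo, K * (p k)%:R `^ u <= x k.
Proof.
move=> p0 []; rewrite limn_einf_lim => low _.
move: low; have /cvg_lim -> // := @cvg_einfs_sup R (fun k => (x k / (p k)%:R `^ u)%:E).
move=> /ereal_sup_gt[_ [N _ <-]] N0.
(* The tail infimum is a priori an extended real; if it is infinite, any positive constant
   serves. *)
have [K K0 KN] : exists2 K : R, 0 < K & (K%:E <= einfs (fun k => (x k / (p k)%:R `^ u)%:E) N)%E.
  move: N0; case: (einfs _ N) => [r| |]//; first by rewrite lte_fin => r0; exists r.
  by move=> _; exists 1 => //; rewrite leey.
exists K => //; exists N => // k /= Nk.
rewrite -ler_pdivlMr ?powR_gt0 ?ltr0n// -lee_fin (le_trans KN)//.
by apply: ereal_inf_lbound; exists k.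
Qed.

Lemma Theta_pow_upper (R : realType) (x : nat -> R) (p : nat -> nat) (u : R) :
  (forall k, (0 < p k)%N) -> Theta_pow x p u ->
  exists2 K : R, 0 < K & \forall k \near \oo, x k <= K * (p k)%:R `^ u.
Proof.
move=> p0 [_]; rewrite limn_esup_lim => up.
move: up; have /cvg_lim -> // := @cvg_esups_inf R (fun k => (x k / (p k)%:R `^ u)%:E).
move=> /ereal_inf_lt[_ [N _ <-]] N0.
have [K K0 KN] : exists2 K : R, 0 < K & (esups (fun k => (x k / (p k)%:R `^ u)%:E) N <= K%:E)%E.
  move: N0; case: (esups _ N) => [r| |]//; last by exists 1 => //; rewrite leNye.
  move=> _; exists (Num.max r 1); first by rewrite lt_max ltr01 orbT.
  by rewrite lee_fin le_max lexx.
exists K => //; exists N => // k /= Nk.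
rewrite -ler_pdivrMr ?powR_gt0 ?ltr0n// -lee_fin (le_trans _ KN)//.
by apply: ereal_sup_ubound; exists k.
Qed.

Lemma powR_natN_cvg0 (R : realType) (p : nat -> nat) (u : R) :
  u < 0 -> p k @[k --> \oo] --> \oo -> (p k)%:R `^ u @[k --> \oo] --> (0 : R).
Proof.
move=> u0 pk; apply/cvgrPdist_le => e e0.
have ui : u^-1 < 0 by rewrite invr_lt0.
near=> k.
have pk0 : (e `^ u^-1) <= (p k)%:R.
  apply: le_trans (ltW (truncnS_gt _)) _; rewrite ler_nat.
  by near: k; move/cvgnyPgt : pk; apply.
rewrite sub0r normrN ger0_norm ?powR_ge0//.
have y0 : 0 < e `^ u^-1 by exact: powR_gt0.
have eE : (e `^ u^-1) `^ u = e by rewrite -powRrM mulVf ?powRr1 ?ltW// lt_eqF.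
rewrite -eE -[u in leLHS]opprK -[X in _ <= _ `^ X]opprK !(powRN _ (- u)).
rewrite lef_pV2 ?posrE ?powR_gt0//; last exact: lt_le_trans pk0.
by apply: ge0_ler_powR; rewrite ?nnegrE ?oppr_ge0 ?(ltW u0) ?(ltW y0) ?ler0n.
Unshelve. all: by end_near. Qed.

Lemma cvg_prob_of_powR_bound (R : realType) (p : nat -> nat) (pr : nat -> \bar R)
    (C s : R) :
  s < 0 -> p k @[k --> \oo] --> \oo -> (forall k, (0 <= pr k)%E) ->
  (\forall k \near \oo, (pr k <= (C * (p k)%:R `^ s)%:E)%E) ->
  pr k @[k --> \oo] --> 0%E.
Proof.
move=> s0 pk pr0 prC.
apply: (@squeeze_cvge _ _ _ _ (fun=> 0%E) _ (fun k => (C * (p k)%:R `^ s)%:E)).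
- by apply: filterS prC => k ->; rewrite pr0.
- exact: cvg_cst.
- apply: cvg_EFin; first exact: nearW.
  rewrite -[X in _ --> X](mulr0 C); apply: cvgMl_tmp; exact: powR_natN_cvg0.
Qed.

Unset Implicit Arguments.
Set Strict Implicit.

Theorem theorem5p2 (R : realType) (q : nat) (delta beta : R)
  (M : nat -> allometric_model R q)
  (gamma1_hat : forall k : nat, sample (M k) -> 'cV[R]_(dimy (M k)))
  (q_gt0 : (0 < q)%N) (delta_gt0 : 0 < delta) (beta_le1 : beta <= 1)
  (n_cvg : nobs (M k) @[k --> \oo] --> \oo)
  (p_cvg : dimy (M k) @[k --> \oo] --> \oo)
  (n_p_ratio : exists2 L : R, 0 < L &
     (nobs (M k))%:R / (dimy (M k))%:R `^ delta @[k --> \oo] --> L)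
  (signal_order :
     Theta_pow (fun k => signal (M k)) (fun k => dimy (M k)) delta)
  (trace_order :
     Theta_pow (fun k => \tr (Sigma (M k))) (fun k => dimy (M k)) 1)
  (gap_order :
     Theta_pow (fun k => eigengap (M k)) (fun k => dimy (M k)) beta)
  (gamma1_hat_random : forall k : nat, random_vector (gamma1_hat k))
  (gamma1_hat_principal : forall (k : nat) (w : sample (M k)),
     principal_eigenvector (S_mix (optimal_weight (M k)) w) (gamma1_hat k w))
  (delta_gt : Num.min (2 - 2 * beta) 1 < delta) :
  cvg_prob0 (fun k => prob (M k)) (fun k w => sign_dist (gamma1_hat k w)).
Proof.
have p0 k : (0 < dimy (M k))%N := leq_trans (isT : (0 < 2)%N) (dimy_ge2 (M k)).
have p0R k : 0 < (dimy (M k))%:R :> R by rewrite ltr0n.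
have [kc kc0 c_ge] := Theta_pow_lower p0 signal_order.
have [kt kt0 t_ge] := Theta_pow_lower p0 trace_order.
have [Kt Kt0 t_le] := Theta_pow_upper p0 trace_order.
have [kd kd0 d_ge] := Theta_pow_lower p0 gap_order.
have [L L0 ratio] := n_p_ratio.
have ratio_ge : \forall k \near \oo,
    L / 2 <= (nobs (M k))%:R / (dimy (M k))%:R `^ delta.
  by apply: (cvgr_ge _ ratio); lra.
move=> eps eps0; have e0 : 0 < 16 / eps ^+ 2 by rewrite divr_gt0// exprn_gt0.
have tail : \forall k \near \oo,
    let c := signal (M k) in
    let t := \tr (Sigma (M k)) in
    let m : R := (nobs (M k) - q.+1)%:R in
    let pr := prob (M k) [set w | (eps < `|sign_dist (gamma1_hat k w)|)%R] in
    (pr <= ((2 * q%:R * t ^+ 2 + 4 * t * c) / c ^+ 2 * (16 / eps ^+ 2))%:E)%E /\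
    (pr <= (2 * t ^+ 2 / (m * eigengap (M k) ^+ 2) * (16 / eps ^+ 2))%:E)%E.
  near=> k; apply: optimal_weight_tail => //.
    apply: (@lt_le_trans _ _ (kc * (dimy (M k))%:R `^ delta)); last by near: k.
    by rewrite mulr_gt0// powR_gt0.
  apply: (@lt_le_trans _ _ (kt * (dimy (M k))%:R `^ 1)); last by near: k.
  by rewrite mulr_gt0// powR_gt0.
move: delta_gt; rewrite gt_min => /orP[delta_gt|delta_gt].
(* The order of t^2 / (m d^2) is p^s with s = 2 - delta - 2 beta, written as a sum of single
   exponents so that the power splits into factors. *)
- pose s := 1 + 1 - delta - beta - beta.
  pose C := 2 * Kt ^+ 2 / (L / 4 * kd ^+ 2) * (16 / eps ^+ 2).
  apply: (@cvg_prob_of_powR_bound _ _ _ C s _ p_cvg).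
  + by rewrite /s; lra.
  + by move=> k; exact: measure_ge0.
  near=> k; apply: (@le_trans _ _ (2 * \tr (Sigma (M k)) ^+ 2 /
     ((nobs (M k) - q.+1)%:R * eigengap (M k) ^+ 2) * (16 / eps ^+ 2))%:E).
    by near: k; apply: filterS tail => k [].
  rewrite lee_fin /C -[leRHS]mulrAC ler_pM2r//.
  have tk : \tr (Sigma (M k)) <= Kt * (dimy (M k))%:R `^ 1 by near: k.
  have tg : kt * (dimy (M k))%:R `^ 1 <= \tr (Sigma (M k)) by near: k.
  have dk : kd * (dimy (M k))%:R `^ beta <= eigengap (M k) by near: k.
  have rk : L / 2 <= (nobs (M k))%:R / (dimy (M k))%:R `^ delta by near: k.
  (* This gives n - (q + 1) >= n / 2, which turns the constant L / 2 into L / 4. *)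
  have nq : (q.+1 * 2 <= nobs (M k))%N by near: k; move/cvgnyPge : n_cvg; apply.
  move: tk tg dk rk; set x : R := (dimy (M k))%:R; have x0 : 0 < x by exact: p0R.
  rewrite powRr1 ?(ltW x0)// => tk tg dk rk.
  have x_neq0 : x != 0 by rewrite gt_eqF.
  have m_ge : L / 4 * x `^ delta <= (nobs (M k) - q.+1)%:R.
    move: rk; rewrite ler_pdivlMr ?powR_gt0// => rk.
    rewrite natrB; last by rewrite (leq_trans _ nq)// leq_pmulr.
    have : (q.+1)%:R * 2 <= (nobs (M k))%:R :> R by rewrite -natrM ler_nat.
    lra.
  have t0 : 0 <= \tr (Sigma (M k)).
    by apply: le_trans tg; rewrite mulr_ge0// ltW.
  have xs : x `^ s = x ^+ 2 / (x `^ delta * (x `^ beta) ^+ 2).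
    rewrite /s !powRB ?x_neq0 ?implybT// powRD ?x_neq0 ?implybT//.
    rewrite powRr1 ?ltW//; field.
    by rewrite !gt_eqF ?powR_gt0.
  rewrite xs.
  have -> : 2 * Kt ^+ 2 / (L / 4 * kd ^+ 2) * (x ^+ 2 / (x `^ delta * (x `^ beta) ^+ 2)) =
     2 * (Kt * x) ^+ 2 / ((L / 4 * x `^ delta) * (kd * x `^ beta) ^+ 2).
    by field; rewrite !gt_eqF ?powR_gt0.
  have den0 : 0 < L / 4 * x `^ delta * (kd * x `^ beta) ^+ 2.
    by rewrite mulr_gt0 ?exprn_gt0 ?mulr_gt0 ?powR_gt0 ?divr_gt0.
  have den : L / 4 * x `^ delta * (kd * x `^ beta) ^+ 2 <=
      (nobs (M k) - q.+1)%:R * eigengap (M k) ^+ 2.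
    apply: ler_pM => //.
    + by rewrite mulr_ge0 ?powR_ge0 ?divr_ge0// ltW.
    + exact: sqr_ge0.
    + rewrite ler_pXn2r ?nnegrE//; last exact/ltW/eigengap_gt0.
      by rewrite mulr_ge0 ?powR_ge0// ltW.
  apply: ler_pM.
  + by rewrite mulr_ge0// sqr_ge0.
  + by rewrite invr_ge0 (le_trans (ltW den0)).
  + rewrite ler_pM2l// ler_pXn2r ?nnegrE//; exact: le_trans tk.
  + by rewrite lef_pV2 ?posrE// (lt_le_trans den0).
- pose s := 1 - delta.
  pose C := (2 * q%:R * (Kt / kc) ^+ 2 + 4 * (Kt / kc)) * (16 / eps ^+ 2).
  apply: (@cvg_prob_of_powR_bound _ _ _ C s _ p_cvg).
  + by rewrite /s; lra.
  + by move=> k; exact: measure_ge0.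
  near=> k; apply: (@le_trans _ _ ((2 * q%:R * \tr (Sigma (M k)) ^+ 2 +
     4 * \tr (Sigma (M k)) * signal (M k)) / signal (M k) ^+ 2 * (16 / eps ^+ 2))%:E).
    by near: k; apply: filterS tail => k [].
  rewrite lee_fin /C -[leRHS]mulrAC ler_pM2r//.
  have tk : \tr (Sigma (M k)) <= Kt * (dimy (M k))%:R `^ 1 by near: k.
  have tg : kt * (dimy (M k))%:R `^ 1 <= \tr (Sigma (M k)) by near: k.
  have ck : kc * (dimy (M k))%:R `^ delta <= signal (M k) by near: k.
  move: tk tg ck; set x : R := (dimy (M k))%:R; have x0 : 0 < x by exact: p0R.
  rewrite powRr1 ?(ltW x0)//.
  have x_neq0 : x != 0 by rewrite gt_eqF.
  have x1 : 1 <= x by rewrite ler1n.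
  set t := \tr _; set c := signal _ => tk tg ck.
  have t0 : 0 <= t.
    by apply: le_trans tg; rewrite mulr_ge0// ltW.
  have ck0 : 0 < kc * x `^ delta by rewrite mulr_gt0 ?powR_gt0.
  have c0 : 0 < c by exact: lt_le_trans ck.
  pose y := x `^ s; have y0 : 0 <= y by exact: powR_ge0.
  (* The bound is 2 q (t/c)^2 + 4 (t/c) with t/c of order y = p^(1 - delta); y <= 1 lets the
     quadratic term be absorbed into the linear rate. *)
  have y1 : y <= 1 by rewrite -(powRr0 x) ler_powR// /s; lra.
  have tc : t / c <= Kt / kc * y.
    have -> : Kt / kc * y = Kt * x / (kc * x `^ delta).
      rewrite /y /s powRB ?x_neq0 ?implybT// powRr1 ?ltW//; field.
      by rewrite !gt_eqF ?powR_gt0.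
    by apply: ler_pM => //; rewrite ?invr_ge0 ?(ltW c0)// lef_pV2 ?posrE.
  have tc0 : 0 <= t / c by rewrite divr_ge0// ltW.
  have -> : (2 * q%:R * t ^+ 2 + 4 * t * c) / c ^+ 2 =
      2 * q%:R * (t / c) ^+ 2 + 4 * (t / c) by field; rewrite gt_eqF.
  have Kc0 : 0 < Kt / kc by rewrite divr_gt0.
  rewrite -/y [leRHS]mulrDl; apply: lerD; last by rewrite -mulrA ler_pM2l.
  rewrite -[leRHS]mulrA; apply: ler_wpM2l; first by rewrite mulr_ge0.
  apply: (@le_trans _ _ ((Kt / kc * y) ^+ 2)).
    by rewrite ler_pXn2r ?nnegrE// mulr_ge0// ltW.
  by rewrite exprMn ler_pM2l ?exprn_gt0// expr2 ler_piMl.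
Unshelve. all: by end_near. Qed.
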